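(* A countable, locally finite CW complex $L$ possesses the connected pairs property with respect to Polish spaces if and only if $L$ is quasi-finite.
   Context: All spaces are Tychonoff and all maps continuous. For spaces $X,Y$, $Y\in AE(X)$ means every map defined on a closed subspace of $X$ into $Y$ extends over $X$. For a normal space $X$, $\text{e-}\dim X\le [L]$ means $L\in AE(X)$. For a normal space $X$, a pair of spaces $V\subset U$ is $X$-connected if for every closed $A\subset X$ every map $A\to V$ extends to a map $X\to U$; the pair is $[L]$-connected with respect to Polish spaces if it is $Z$-connected for every Polish space $Z$ with $\text{e-}\dim Z\le [L]$. $L$ possesses the connected pairs property with respect to Polish spaces if for every metrizable compactum $K$ with $\text{e-}\dim K\le [L]$ there is a metrizable compactum $C\supset K$ with $\text{e-}\dim C\le [L]$ such that the pair $K\subset C$ is $[L]$-connected with respect to Polish spaces. $L$ is quasi-finite if for every finite subcomplex $P$ of $L$ there is a finite subcomplex $P'\supset P$ of $L$ such that the pair $P\subset P'$ is $[L]$-connected with respect to Polish spaces. *)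

(* Defs.v *)
From HB Require Import structures.
From mathcomp Require Import all_boot all_order all_algebra.
From mathcomp Require Import all_classical all_reals all_analysis.
From mathcomp Require Import Rstruct Rstruct_topology.

Set Implicit Arguments.
Unset Strict Implicit.
Unset Printing Implicit Defensive.
Import Order.TTheory GRing.Theory Num.Theory.
Local Open Scope classical_set_scope.
Local Open Scope ring_scope.

Notation RR := Rdefinitions.R.

Definition is_metric (T : Type) (d : T -> T -> RR) : Prop :=
  (forall x y, 0 <= d x y) /\ (forall x y, d x y = 0 <-> x = y) /\
  (forall x y, d x y = d y x) /\ (forall x y z, d x z <= d x y + d y z).

Definition metric_induces (T : topologicalType) (d : T -> T -> RR) : Prop :=
  forall A : set T, open A <->
    (forall x, A x -> exists e : RR, 0 < e /\ [set y | d x y < e] `<=` A).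

Definition metrizable (T : topologicalType) : Prop :=
  exists d : T -> T -> RR, is_metric d /\ metric_induces d.

Definition d_cauchy (T : Type) (d : T -> T -> RR) (u : nat -> T) : Prop :=
  forall e : RR, 0 < e -> exists N : nat,
    forall m n : nat, (N <= m)%N -> (N <= n)%N -> d (u m) (u n) < e.

Definition completely_metrizable (T : topologicalType) : Prop :=
  exists d : T -> T -> RR, is_metric d /\ metric_induces d /\
    (forall u : nat -> T, d_cauchy d u -> exists x : T, u @ \oo --> x).

Definition separable (T : topologicalType) : Prop :=
  exists S : set T, countable S /\ closure S = setT.

Definition polish (T : topologicalType) : Prop :=
  separable T /\ completely_metrizable T.

Definition metrizable_compactum (T : topologicalType) : Prop :=
  compact [set: T] /\ metrizable T.

(* Y \in AE(X): every map from a closed subspace A of X into Y extends over X.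
   A map A -> Y is represented by a function X -> Y continuous on A (only
   its values on A matter); the first conjunct accounts for the empty map
   on A = set0 (which exists even when Y is empty). *)
Definition AE (X Y : topologicalType) : Prop :=
  ((exists y : Y, True) \/ ~ (exists x : X, True)) /\
  forall (A : set X) (f : X -> Y), closed A -> {within A, continuous f} ->
    exists g : X -> Y, continuous g /\ (forall x, A x -> g x = f x).

Definition edim_le (X L : topologicalType) : Prop := AE X L.

Definition X_connected (X T : topologicalType) (V U : set T) : Prop :=
  V `<=` U /\
  ((exists u, U u) \/ ~ (exists x : X, True)) /\
  forall (A : set X) (f : X -> T), closed A -> {within A, continuous f} ->
    f @` A `<=` V ->
    exists g : X -> T, continuous g /\ range g `<=` U /\
      (forall x, A x -> g x = f x).

Definition L_connected_Polish (L T : topologicalType) (V U : set T) : Prop :=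
  forall Z : topologicalType, polish Z -> edim_le Z L -> X_connected Z V U.

Definition embedding (K C : topologicalType) (e : K -> C) : Prop :=
  continuous e /\ injective e /\
  forall O : set K, open O -> exists W : set C, open W /\ e @` O = W `&` range e.

Definition connected_pairs_property (L : topologicalType) : Prop :=
  forall K : topologicalType, metrizable_compactum K -> edim_le K L ->
    exists (C : topologicalType) (e : K -> C),
      embedding e /\ metrizable_compactum C /\ edim_le C L /\
      L_connected_Polish L (range e) [set: C].

Definition sqnorm (n : nat) (x : 'rV[RR]_n) : RR := \sum_(i < n) x ord0 i ^+ 2.
Definition disk (n : nat) : set 'rV[RR]_n := [set x | sqnorm x <= 1].
Definition open_disk (n : nat) : set 'rV[RR]_n := [set x | sqnorm x < 1].
Definition sphere (n : nat) : set 'rV[RR]_n := [set x | sqnorm x = 1].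
Arguments disk n : clear implicits.
Arguments open_disk n : clear implicits.
Arguments sphere n : clear implicits.

Record cell_data (L : topologicalType) := CellData {
  cw_I : Type;
  cw_dim : cw_I -> nat;
  cw_char : forall i : cw_I, 'rV[RR]_(cw_dim i) -> L }.
Arguments cw_I {L} c : rename.
Arguments cw_dim {L c} i : rename.
Arguments cw_char {L c} i _ : rename.

Definition ocell (L : topologicalType) (W : cell_data L) (i : cw_I W) : set L :=
  cw_char i @` open_disk (cw_dim i).
Definition ccell (L : topologicalType) (W : cell_data L) (i : cw_I W) : set L :=
  cw_char i @` disk (cw_dim i).

Definition is_CW (L : topologicalType) (W : cell_data L) : Prop :=
  hausdorff_space L /\
  (forall i : cw_I W, {within disk (cw_dim i), continuous (cw_char i)}) /\
  (forall (i : cw_I W) x y, open_disk (cw_dim i) x -> open_disk (cw_dim i) y ->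
      cw_char i x = cw_char i y -> x = y) /\
  (forall (i : cw_I W) (O : set 'rV[RR]_(cw_dim i)), open O ->
      exists G : set L, open G /\
        cw_char i @` (O `&` open_disk (cw_dim i)) = G `&` ocell i) /\
  (forall x : L, exists i : cw_I W, ocell i x) /\
  (forall (i j : cw_I W) x, ocell i x -> ocell j x -> i = j) /\
  (forall i : cw_I W, exists J : set (cw_I W), finite_set J /\
      (forall j : cw_I W, J j -> (cw_dim j < cw_dim i)%N) /\
      cw_char i @` sphere (cw_dim i) `<=` \bigcup_(j in J) ocell j) /\
  (forall A : set L, (forall i : cw_I W, closed (A `&` ccell i)) -> closed A).

Definition CW_countable (L : topologicalType) (W : cell_data L) : Prop :=
  countable [set: cw_I W].

Definition CW_locally_finite (L : topologicalType) (W : cell_data L) : Prop :=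
  forall x : L, exists N : set L, nbhs x N /\
    finite_set [set i : cw_I W | N `&` ocell i !=set0].

Definition cells_union (L : topologicalType) (W : cell_data L) (J : set (cw_I W))
  : set L := \bigcup_(j in J) ocell j.

Definition subcomplex (L : topologicalType) (W : cell_data L) (J : set (cw_I W))
  : Prop := closed (cells_union J).

Definition quasi_finite (L : topologicalType) (W : cell_data L) : Prop :=
  forall P : set (cw_I W), finite_set P -> subcomplex P ->
    exists P' : set (cw_I W), finite_set P' /\ subcomplex P' /\ P `<=` P' /\
      L_connected_Polish L (cells_union P) (cells_union P').

(* Main.v *)
(* Every finite subcomplex of L is a Euclidean neighbourhood retract.

   If L has the connected pairs property, then for each simplex one builds a compactum
   K of extension dimension at most L with a map to the simplex which is universal
   for Polish spaces of extension dimension at most L: starting from a point, one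
   adds the faces by increasing dimension, gluing in for each face the compactum
   which the connected pairs property provides over the boundary of that face.
   Sending the vertices of the simplex to a fine net of a finite subcomplex P in its
   Euclidean neighbourhood and composing with the retraction gives a map of a
   compactum into L through which all maps into P factor up to a small motion; its
   image lies in a finite subcomplex P', and the motion is absorbed by the retraction.

   If L is quasi-finite, a compactum K is embedded in a subset C of a countable power
   of the real line. A point of C carries a point of the Hilbert cube together with
   its images under solutions of countably many extension problems of maps into
   finite subcomplexes P. The n-th problem depends only on the previous coordinates,
   and by the Kakutani-Stone theorem these problems exhaust, up to small motions, all
   extension problems on C, so that e-dim C <= [L]. A map into K is solved along the
   first step P -> P' of the quasi-finiteness chain P -> P' -> P'', which leaves the
   second step for extending maps from closed subsets of Polish spaces. *)
Require Import Defs.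
From mathcomp Require Import all_boot all_order all_algebra.
From mathcomp Require Import finmap.
From mathcomp Require Import all_classical all_reals all_analysis.
From mathcomp Require Import Rstruct Rstruct_topology.
From mathcomp Require Import ring lra.

Set Implicit Arguments.
Unset Strict Implicit.
Unset Printing Implicit Defensive.
Import Order.TTheory GRing.Theory Num.Theory.
Import numFieldNormedType.Exports.
Local Open Scope classical_set_scope.
Local Open Scope ring_scope.

(** Extension dimension yields exact extensions, but only into all of [L], whereas both directions
    need control over where an extension goes. Euclidean neighbourhoods reconcile the two: maps that
    are close there are joined by segments, a Urysohn function travels along them from one map to
    the other, and the retraction brings the result back into the subcomplex. This is [patch]; it
    serves both directions and replaces homotopy extension for complexes. Local finiteness puts a
    compact subset of [L] inside the interior of a finite subcomplex, which leaves room for the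
    switch; countability makes the finite subcomplexes, hence the extension problems, enumerable.
    Therefore problems are posed as formulas in the coordinates of the ambient product, and a point
    of [C] carries values of solutions rather than [C] carrying chosen functions. *)

Lemma within_closedP (X Y : topologicalType) (A : set X) (f : X -> Y) :
  closed A ->
  ({within A, continuous f} <->
   forall B : set Y, closed B -> closed (A `&` f @^-1` B)).
Proof.
move=> cA; rewrite continuous_closedP; split=> H B cB.
  by rewrite closed_setSI//; exact: H.
by rewrite -closed_setSI//; exact: H.
Qed.

Lemma within_comp (X Y Z : topologicalType) (A : set X) (B : set Y)
    (f : X -> Y) (g : Y -> Z) :
  {within A, continuous f} -> (forall x, A x -> B (f x)) ->
  {within B, continuous g} -> {within A, continuous (g \o f)}.
Proof.
move=> /subspace_continuousP cf AB /subspace_continuousP cg.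
apply/subspace_continuousP => x Ax U /(cg _ (AB _ Ax)) /= nU.
have := cf _ Ax _ nU; rewrite /= /nbhs /= /within /=.
by apply: filterS => z /= H Az; apply: H => //; exact: AB.
Qed.

Lemma within_eq (X Y : topologicalType) (A : set X) (f g : X -> Y) :
  (forall x, A x -> f x = g x) -> {within A, continuous f} ->
  {within A, continuous g}.
Proof.
by move=> fg; apply: subspace_eq_continuous => x /set_mem Ax /=; exact: fg.
Qed.

Lemma paste_within (X Y : topologicalType) (A B : set X) (f g : X -> Y) :
  closed A -> closed B -> {within A, continuous f} -> {within B, continuous g} ->
  (forall x, A x -> B x -> f x = g x) ->
  {within A `|` B, continuous (fun x => if `[< A x >] then f x else g x)}.
Proof.
move=> cA cB cf cg fg; apply: withinU_continuous => //.
  by apply: within_eq cf => x Ax; case: asboolP.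
by apply: within_eq cg => x Bx; case: asboolP => // Ax; rewrite fg.
Qed.

Lemma paste_continuous (X Y : topologicalType) (A B : set X) (f g : X -> Y) :
  closed A -> closed B -> (forall x, A x \/ B x) ->
  {within A, continuous f} -> {within B, continuous g} ->
  (forall x, A x -> B x -> f x = g x) ->
  continuous (fun x => if `[< A x >] then f x else g x).
Proof.
move=> cA cB AB cf cg fg; apply/continuous_subspace_setT.
have -> : setT = A `|` B by apply/seteqP; split=> x // _; exact: AB.
exact: paste_within.
Qed.

(** A map from a compact set to a Hausdorff space is closed, hence a quotient map onto its image, so
    continuity of [h] can be tested after composing with [p]. Maps on glued pieces are handled this
    way. *)
Lemma compact_quotient (X Y Z : topologicalType) (K : set X) (p : X -> Y)
    (h : Y -> Z) :
  compact K -> hausdorff_space Y -> {within K, continuous p} -> closed K ->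
  {within K, continuous (h \o p)} -> {within p @` K, continuous h}.
Proof.
move=> kK hY cp cK chp.
have cpK : closed (p @` K) by apply: compact_closed => //; exact: continuous_compact.
apply/within_closedP => // B cB.
have -> : p @` K `&` h @^-1` B = p @` (K `&` (h \o p) @^-1` B).
  apply/seteqP; split=> y.
    by move=> [[x Kx <-] Bx]; exists x.
  by move=> [x [Kx Bx] <-]; split=> //; exists x.
have cl : closed (K `&` (h \o p) @^-1` B) by exact: (within_closedP _ cK).1.
apply: compact_closed => //; apply: continuous_compact.
  by apply: continuous_subspaceW cp => x [].
exact: (subclosed_compact cl kK).
Qed.

Lemma compact_inverse (X Y : topologicalType) (K : set X) (p : X -> Y)
    (g : Y -> X) :
  compact K -> closed K -> hausdorff_space Y -> {within K, continuous p} ->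
  (forall x, K x -> g (p x) = x) -> {within p @` K, continuous g}.
Proof.
move=> kK cK hY cp gp; apply: compact_quotient => //.
apply: (@within_eq _ _ _ idfun) => [x Kx|]; first by rewrite /= gp.
by apply: continuous_subspaceT => x; exact: cvg_id.
Qed.

Lemma continuous_row (X : topologicalType) (n : nat) (f : X -> 'rV[RR]_n) :
  (forall i, continuous (fun x => f x ord0 i)) -> continuous f.
Proof.
move=> cf x; apply/cvg_ballP => e e0.
rewrite /= near_map.
have : \forall y \near x, forall i, `|f x ord0 i - f y ord0 i| < e.
  apply: filter_forall => i; exact: (cvg_ball (cf i x) e0).
apply: filterS => y H; rewrite /ball /=; split=> // i j.
by rewrite ord1; exact: H.
Qed.

Lemma row_coord_le (n : nat) (v : 'rV[RR]_n) (i : 'I_n) : `|v ord0 i| <= `|v|.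
Proof.
have -> : `|v| = mx_norm v by [].
rewrite mx_normrE.
exact: (@le_bigmax _ _ _ _ (fun ij : 'I_1 * 'I_n => `|v ij.1 ij.2|) (ord0, i)).
Qed.

Lemma tietze_row (X : topologicalType) (n : nat) (A : set X)
    (f : X -> 'rV[RR]_n) (B : RR) :
  normal_space X -> closed A -> {within A, continuous f} ->
  (forall x, A x -> `|f x| <= B) ->
  exists g : X -> 'rV[RR]_n, continuous g /\ forall x, A x -> g x = f x.
Proof.
move=> nX cA cf fB.
have coord i : exists g : X -> RR, continuous g /\ forall x, A x -> g x = f x ord0 i.
  have B1 : (0 : RR) < `|B| + 1 by rewrite ltr_wpDl.
  have c : {within A, continuous (fun x => f x ord0 i)}.
    apply: (@within_comp _ _ _ _ setT f (fun v : 'rV_n => v ord0 i)) => //.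
    by apply/continuous_subspaceT; exact: coord_continuous.
  have b x : A x -> `|f x ord0 i| <= `|B| + 1.
    move=> Ax; apply: (@le_trans _ _ `|f x|); last first.
      by rewrite (le_trans (fB x Ax))// (le_trans (ler_norm _))// lerDl.
    exact: row_coord_le.
  have [g [g1 g2 _]] := continuous_bounded_extension nX cA B1 c b.
  by exists g; split=> // x Ax; rewrite g1 ?inE.
have [g gP] := choice coord.
exists (fun x => \row_i g i x); split.
  apply: continuous_row => i; rewrite (_ : (fun _ => _) = g i); first exact: (gP i).1.
  by apply/funext => x; rewrite mxE.
by move=> x Ax; apply/rowP => i; rewrite mxE (gP i).2.
Qed.

Lemma urysohn01 (X : topologicalType) (A B : set X) :
  normal_space X -> closed A -> closed B -> A `&` B = set0 ->
  exists f : X -> RR, [/\ continuous f, (forall x, A x -> f x = 0),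
    (forall x, B x -> f x = 1) & forall x, 0 <= f x <= 1].
Proof.
move=> nX cA cB AB.
have [f [cf fA fB fr]] := urysohn_ext_itv nX cA cB AB (@ltr01 RR).
exists f; split=> // x.
- by move=> Ax; apply: fA; exists x.
- by move=> Bx; apply: fB; exists x.
- by have := fr (f x) (ex_intro2 _ _ x I erefl); rewrite /= in_itv.
Qed.

Lemma compact_finite_net (T : topologicalType) (K : set T) (N : T -> set T) :
  compact K -> (forall x, K x -> nbhs x (N x)) ->
  exists2 s : seq T, (forall x, x \in s -> K x) &
    forall x, K x -> exists2 y, y \in s & N y x.
Proof.
move=> /compact_near_coveringP cK KN.
(* Finite sequences in [K], directed by inclusion, generate a filter; the near-covering form of
   compactness for this filter yields one sequence that serves all points at once. *)
pose G (s : seq T) := [set t : seq T | {subset s <= t} /\ forall y, y \in t -> K y].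
have FG : Filter (filter_from [set s : seq T | forall y, y \in s -> K y] G).
  apply: filter_from_filter; first by exists [::].
  move=> s t sK tK; exists (s ++ t).
    by move=> y /=; rewrite mem_cat => /orP[/sK|/tK].
  move=> r [str rK]; split; split=> // y yr; apply: str; rewrite mem_cat yr ?orbT//.
have [x Kx|s sK] := cK _ _ (fun (s : seq T) x => exists2 y, y \in s & N y x) FG.
  exists (N x, G [:: x]); first split => /=; first exact: KN.
    by exists [:: x] => // y; rewrite inE => /eqP ->.
  by move=> [z t] [/= Nz [xt _]]; exists x => //; apply: xt; rewrite inE.
by move=> /(_ s) H; exists s => //; apply: H; split.
Qed.

(** * Metric spaces: normality, compacta, separating functions *)

Section metric.
Variables (T : topologicalType) (d : T -> T -> RR).
Hypothesis md : is_metric d.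

Let dge0 x y : 0 <= d x y. Proof. by case: md. Qed.
Let dxx x : d x x = 0. Proof. by case: md => _ [/(_ x x) + _]; case=> _; apply. Qed.
Let d0 x y : d x y = 0 -> x = y. Proof. by case: md => _ [/(_ x y) [+ _] _]; apply. Qed.
Let dC x y : d x y = d y x. Proof. by case: md => _ [_ [-> _]]. Qed.
Let dtri x y z : d x z <= d x y + d y z. Proof. by case: md => _ [_ [_]]; apply. Qed.

(** The complement of an open set is compact, so a point of the open set has positive distance from
    it; the filter [0^'+] of small radii extracts that distance. *)
Lemma compact_metric_induces :
  compact [set: T] -> (forall x e, 0 < e -> nbhs x [set y | d x y < e]) ->
  metric_induces d.
Proof.
move=> cT nb A; split=> [oA x Ax|H]; last first.
  rewrite openE => x /H [e [e0 sA]]; exact: filterS sA (nb _ _ e0).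
have /compact_near_coveringP : compact (~` A).
  by apply: subclosed_compact cT _ => //; exact: open_closedC.
move=> /(_ _ (0 : RR)^'+ (fun e y => e <= d x y) _) [y nAy|].
  have xy : 0 < d x y.
    by rewrite lt_neqAle dge0 andbT eq_sym; apply/eqP => /d0 xy; apply: nAy; rewrite -xy.
  exists ([set z | d y z < d x y / 2], [set e | e < d x y / 2]) => /=.
    by split; [apply: nb; rewrite divr_gt0|apply: nbhs_right_lt; rewrite divr_gt0].
  by move=> [z e] [/= zy ey]; have := dtri x z y; rewrite (dC z y); lra.
move=> e /= e0 He; exists (e / 2); split; first by rewrite divr_gt0.
move=> y /=; rewrite ltNge => /negP He'.
apply: contrapT => nA; apply: He'; apply: He => //=.
  by rewrite sub0r normrN gtr0_norm ?divr_gt0//; lra.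
by rewrite divr_gt0.
Qed.

Hypothesis mi : metric_induces d.

Lemma metric_nbhsP x (A : set T) :
  nbhs x A <-> exists e, 0 < e /\ [set y | d x y < e] `<=` A.
Proof.
split=> [|[e [e0 sA]]].
  rewrite nbhsE => -[B [oB Bx] BA].
  by have [e [e0 eB]] := (mi B).1 oB x Bx; exists e; split=> // y /eB/BA.
rewrite nbhsE; exists [set y | d x y < e] => //; split; last by rewrite /= dxx.
apply/mi => y /= xy; exists (e - d x y); split; first by rewrite subr_gt0.
by move=> z /= yz; have := dtri x y z; lra.
Qed.

Lemma metric_hausdorff : hausdorff_space T.
Proof.
move=> p q pq; apply: contrapT => npq.
have e0 : 0 < d p q / 2.
  by rewrite divr_gt0// lt_neqAle dge0 andbT eq_sym; apply/eqP => /d0.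
have [||z [/= zp zq]] := pq [set y | d p y < d p q / 2] [set y | d q y < d p q / 2].
  by apply/metric_nbhsP; exists (d p q / 2); split.
  by apply/metric_nbhsP; exists (d p q / 2); split.
by have := dtri p z q; rewrite (dC z q); lra.
Qed.

Lemma metric_normal : normal_space T.
Proof.
apply/(@normal_openP RR) => A B cA cB AB.
(* Balls of half the distance to the other set: by the triangle inequality two such balls from
   opposite sides cannot meet. *)
pose N (A B : set T) := [set z | exists x e, [/\ A x, 0 < e, d x z < e / 2 &
  forall y, B y -> e <= d x y]].
have oN A' B' : open (N A' B').
  rewrite openE => z [x [e [Ax e0 xz eB]]].
  apply/metric_nbhsP; exists (e / 2 - d x z); split; first by rewrite subr_gt0.
  move=> y /= zy; exists x, e; split=> //; have := dtri x z y; lra.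
have sN A' B' : closed B' -> A' `&` B' = set0 -> A' `<=` N A' B'.
  move=> cB' AB' x Ax.
  have : nbhs x (~` B').
    apply: open_nbhs_nbhs; split; first exact: closed_openC.
    by move=> Bx; have : (A' `&` B') x by []; rewrite AB'.
  move=> /metric_nbhsP [e [e0 eB]]; exists x, e; split=> //.
    by rewrite dxx divr_gt0.
  by move=> y By; rewrite leNgt; apply/negP => /eB.
exists (N A B), (N B A); split=> //; [exact: sN| by apply: sN => //; rewrite setIC|].
apply/seteqP; split=> z //= [[x [e [Ax e0 xz eB]]] [y [e' [By e'0 yz eA]]]].
have := eB _ By; have := eA _ Ax; have := dtri x z y.
by rewrite (dC z y) (dC y x); lra.
Qed.

Lemma metric_continuous a : continuous (d a : T -> RR).
Proof.
move=> x; apply/cvg_ballP => e e0; rewrite near_map.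
apply/metric_nbhsP; exists e; split=> // y /= xy.
rewrite /ball /=; have := dtri a x y; have := dtri a y x; rewrite (dC y x).
by rewrite ltr_norml; lra.
Qed.

Lemma compact_metric_separable : compact [set: T] -> separable T.
Proof.
move=> cT.
have net n : exists D : seq T, forall x, exists2 y, y \in D & d y x < n.+1%:R^-1.
  have [x _|D _ DP] := compact_finite_net (N := fun x => [set y | d x y < n.+1%:R^-1]) cT.
    by apply/metric_nbhsP; exists n.+1%:R^-1; split; rewrite ?invr_gt0.
  by exists D => x; exact: DP.
have [D DP] := choice net.
exists (\bigcup_n [set` D n]); split.
  by apply: bigcup_countable => // n _; exact: finite_set_countable.
apply/seteqP; split=> // x _ B /metric_nbhsP [e [e0 eB]].
have [n ne] : exists n, n.+1%:R^-1 < e.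
  have [n _ /(_ n (leqnn n)) /=] := near_infty_natSinv_lt (PosNum e0).
  by exists n.
have [y Dy yx] := DP n x; exists y; split; first by exists n.
by apply: eB => /=; rewrite dC; exact: lt_trans ne.
Qed.

Lemma compact_metric_complete (u : nat -> T) :
  compact [set: T] -> d_cauchy d u -> exists x : T, u n @[n --> \oo] --> x.
Proof.
move=> cT cu; have [x [_ clx]] := cT (u @ \oo) _ filterT.
exists x => A /metric_nbhsP [e [e0 eA]].
have e20 : 0 < e / 2 by rewrite divr_gt0.
have [N uN] := cu _ e20.
have [||z [[m /= Nm <-] xz]] := clx [set u m | m in [set m | (N <= m)%N]]
    [set y | d x y < e / 2].
- by exists N => // m /= Nm; exists m.
- by apply/metric_nbhsP; exists (e / 2); split.
exists N => // n /= Nn; apply: eA => /=.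
by have := uN _ _ Nm Nn; have := dtri x (u m) (u n); move: xz => /=; lra.
Qed.

(** Distances to a countable dense set, cut off at [1] so that they are coordinates in the Hilbert
    cube. For distinct [x] and [y], a dense point closer to [x] than both [1] and half of [d x y]
    tells them apart. *)
Lemma metric_separating : separable T -> exists phi : nat -> T -> RR,
  [/\ forall k, continuous (phi k), forall k x, 0 <= phi k x <= 1 &
      forall x y, (forall k, phi k x = phi k y) -> x = y].
Proof.
move=> [S [/countable_injP [f finj] dS]].
have dense x e : 0 < e -> exists2 s, S s & d x s < e.
  move=> e0; have : closure S x by rewrite dS.
  have nb : nbhs x [set y | d x y < e] by apply/metric_nbhsP; exists e; split.
  by move=> /(_ _ nb) [s [Ss xs]]; exists s.
have ex k : exists g : T -> RR, [/\ continuous g, forall x, 0 <= g x <= 1 &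
    forall s, S s -> f s = k -> forall x, g x = Order.min 1 (d s x)].
  have [[s [Ss fs]]|nex] := pselect (exists s, S s /\ f s = k).
    exists (fun x => Order.min 1 (d s x)); split.
    - move=> x; apply: (@continuous_min RR _ (fun=> 1) (d s)); first exact: cvg_cst.
      exact: metric_continuous.
    - by move=> x; rewrite le_min ler01 dge0 ge_min lexx.
    - by move=> t St ft x; rewrite (finj s t)// ?inE// fs.
  exists (fun=> 0); split; first by move=> x; exact: cvg_cst.
    by move=> x; rewrite lexx ler01.
  by move=> s Ss fs; exfalso; apply: nex; exists s.
have [phi phiP] := choice ex.
exists phi; split=> [k|k|x y xy]; [by case: (phiP k)|by case: (phiP k)|].
apply: d0; apply/eqP; rewrite eq_le dge0 andbT leNgt; apply/negP => xy0.
have [e [e0 e1 e2]] : exists e : RR, [/\ 0 < e, e <= 1 & e <= d x y / 2].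
  by exists (Order.min 1 (d x y / 2)); rewrite lt_min ltr01 divr_gt0// !ge_min !lexx orbT.
have [s Ss xs] := dense x e e0.
have [_ _ /(_ s Ss erefl) ps] := phiP (f s).
have := xy (f s); rewrite !ps.
rewrite [X in X = _]min_r; last by rewrite dC; lra.
have h1 := dtri x s y; have h2 := dC s x.
by case: (leP 1 (d s y)); lra.
Qed.

End metric.

Lemma metrizable_hausdorff (T : topologicalType) : metrizable T -> hausdorff_space T.
Proof. by move=> [d [md mi]]; exact: metric_hausdorff md mi. Qed.

Lemma metrizable_normal (T : topologicalType) : metrizable T -> normal_space T.
Proof. by move=> [d [md mi]]; exact: metric_normal md mi. Qed.

Lemma polish_normal (T : topologicalType) : polish T -> normal_space T.
Proof. by move=> [_ [d [md [mi _]]]]; exact: metric_normal md mi. Qed.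

Lemma metrizable_compactum_polish (T : topologicalType) :
  metrizable_compactum T -> polish T.
Proof.
move=> [cT [d [md mi]]]; split; first exact: compact_metric_separable md mi cT.
exists d; split=> //; split=> // u; exact: compact_metric_complete md mi u cT.
Qed.

Lemma metrizable_compactum_separating (T : topologicalType) :
  metrizable_compactum T -> exists phi : nat -> T -> RR,
  [/\ forall k, continuous (phi k), forall k x, 0 <= phi k x <= 1 &
      forall x y, (forall k, phi k x = phi k y) -> x = y].
Proof.
move=> [cT [d [md mi]]].
exact: (metric_separating md mi (compact_metric_separable md mi cT)).
Qed.

Lemma separating_metrizable (T : topologicalType) (phi : nat -> T -> RR) :
  compact [set: T] -> (forall k, continuous (phi k)) ->
  (forall x y, (forall k, phi k x = phi k y) -> x = y) -> metrizable T.
Proof.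
move=> cT cphi sep.
(* The cap [1 / (k + 1)] on the [k]-th coordinate leaves only finitely many coordinates to control
   for a given radius, so balls are neighbourhoods. *)
pose E x y : set RR := range (fun k => Order.min `|phi k x - phi k y| k.+1%:R^-1).
pose d x y : RR := sup (E x y).
have E0 x y : E x y !=set0 by exists (Order.min `|phi 0%N x - phi 0%N y| 1%:R^-1); exists 0%N.
have Eub x y : has_ubound (E x y).
  exists 1 => _ [k _ <-]; rewrite ge_min; apply/orP; right.
  by rewrite invf_le1// ler1n.
have dle x y k : Order.min `|phi k x - phi k y| k.+1%:R^-1 <= d x y.
  by apply: ub_le_sup => //; exists k.
have dge x y c : (forall k, Order.min `|phi k x - phi k y| k.+1%:R^-1 <= c) -> d x y <= c.
  by move=> H; apply: ge_sup => // _ [k _ <-].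
have ge0 x y : 0 <= d x y.
  by apply: le_trans (dle x y 0%N); rewrite le_min normr_ge0/= invr1.
have md : is_metric d.
  split=> //; split; [|split].
  - move=> x y; split=> [d0|->].
      apply: sep => k; apply/eqP; rewrite -subr_eq0 -normr_le0.
      have := dle x y k; rewrite d0 ge_min => /orP[//|].
      by rewrite leNgt invr_gt0 ltr0n.
    apply/eqP; rewrite eq_le ge0 andbT; apply: dge => k.
    by rewrite subrr normr0 ge_min lexx.
  - have le x y : d x y <= d y x by apply: dge => k; rewrite distrC.
    by move=> x y; apply/eqP; rewrite eq_le !le.
  - move=> x y z; apply: dge => k.
    have := dle x y k; have := dle y z k; have := ler_normD (phi k x - phi k y) (phi k y - phi k z).
    rewrite addrA subrK.
    set a := `|_|; set b := `|_|; set c := `|_|; set q := _^-1.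
    have b0 : 0 <= b by exact: normr_ge0.
    have c0 : 0 <= c by exact: normr_ge0.
    have q0 : 0 <= q by rewrite invr_ge0.
    by case: (leP a q); case: (leP b q); case: (leP c q); lra.
exists d; split=> //; apply: (compact_metric_induces md cT) => x e e0.
have e20 : 0 < e / 2 by rewrite divr_gt0.
have [N _ HN] := near_infty_natSinv_lt (PosNum e20).
have : \forall y \near x, forall k : 'I_N, `|phi k x - phi k y| < e / 2.
  by apply: filter_forall => k; exact: (cvg_ball (cphi k x) e20).
apply: filterS => y H /=; apply: (@le_lt_trans _ _ (e / 2)); last by lra.
apply: dge => k; rewrite ge_min; case: (ltnP k N) => kN.
  by rewrite (ltW (H (Ordinal kN))).
by apply/orP; right; apply/ltW; exact: (HN k kN).
Qed.

Lemma row_norm_le (n : nat) (v : 'rV[RR]_n) (c : RR) :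
  0 <= c -> (forall i, `|v ord0 i| <= c) -> `|v| <= c.
Proof.
move=> c0 vc; have -> : `|v| = mx_norm v by [].
rewrite mx_normrE; apply/bigmax_leP; split=> // -[i j] _ /=.
by rewrite ord1.
Qed.

Lemma continuous_comp_fun (X Y Z : topologicalType) (f : X -> Y) (g : Y -> Z) :
  continuous f -> continuous g -> continuous (fun x => g (f x)).
Proof. by move=> cf cg x; exact: (@continuous_comp _ _ _ f g x (cf x) (cg _)). Qed.

Lemma open_within (X Y : topologicalType) (A : set X) (f : X -> Y) (x : X) :
  open A -> {within A, continuous f} -> A x -> {for x, continuous f}.
Proof.
by move=> oA; rewrite continuous_open_subspace// => cf Ax; apply: cf; exact/mem_set.
Qed.

Lemma near_gt (X : topologicalType) (f : X -> RR) (c : RR) (x : X) :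
  {for x, continuous f} -> c < f x -> \forall y \near x, c < f y.
Proof. by move=> cf cx; apply: (cf [set z | c < z]); exact: lt_nbhsr. Qed.

Lemma near_lt (X : topologicalType) (f : X -> RR) (c : RR) (x : X) :
  {for x, continuous f} -> f x < c -> \forall y \near x, f y < c.
Proof. by move=> cf cx; apply: (cf [set z | z < c]); exact: lt_nbhsl. Qed.

(** * Continuity at a point *)

Section pointwise.
Variables (X : topologicalType) (V : normedModType RR) (x : X).
Implicit Types (f g : X -> RR) (u v : X -> V).

Lemma cont_vadd u v : {for x, continuous u} -> {for x, continuous v} ->
  {for x, continuous (fun y => u y + v y)}.
Proof. by move=> cu cv; exact: (@cvgD RR V _ _ _ u v). Qed.

Lemma cont_vsub u v : {for x, continuous u} -> {for x, continuous v} ->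
  {for x, continuous (fun y => u y - v y)}.
Proof. by move=> cu cv; exact: (@cvgB RR V _ _ _ u v). Qed.

Lemma cont_vscale f v : {for x, continuous f} -> {for x, continuous v} ->
  {for x, continuous (fun y => f y *: v y)}.
Proof. by move=> cf cv; exact: (@cvgZ RR V _ _ _ f v). Qed.

Lemma cont_vnorm u : {for x, continuous u} -> {for x, continuous (fun y => `|u y|)}.
Proof. by move=> cu; exact: (@cvg_norm RR V _ _ _ u). Qed.

Lemma cont_add f g : {for x, continuous f} -> {for x, continuous g} ->
  {for x, continuous (fun y => f y + g y)}.
Proof. by move=> cu cv; exact: (@cvgD RR RR^o _ _ _ f g). Qed.

Lemma cont_sub f g : {for x, continuous f} -> {for x, continuous g} ->
  {for x, continuous (fun y => f y - g y)}.
Proof. by move=> cu cv; exact: (@cvgB RR RR^o _ _ _ f g). Qed.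

Lemma cont_mul f g : {for x, continuous f} -> {for x, continuous g} ->
  {for x, continuous (fun y => f y * g y)}.
Proof. by move=> cu cv; exact: (@cvgM RR _ _ _ f g). Qed.

Lemma cont_inv f : f x != 0 -> {for x, continuous f} ->
  {for x, continuous (fun y => (f y)^-1)}.
Proof. by move=> f0 cu; exact: (@cvgV RR _ _ _ f). Qed.

Lemma cont_abs f : {for x, continuous f} -> {for x, continuous (fun y => `|f y|)}.
Proof. by move=> cu; exact: (@cvg_norm RR RR^o _ _ _ f). Qed.

Lemma cont_min f g : {for x, continuous f} -> {for x, continuous g} ->
  {for x, continuous (fun y => Order.min (f y) (g y))}.
Proof. by move=> cu cv; exact: (@continuous_min RR X f g). Qed.

Lemma cont_max f g : {for x, continuous f} -> {for x, continuous g} ->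
  {for x, continuous (fun y => Order.max (f y) (g y))}.
Proof. by move=> cu cv; exact: (@continuous_max RR X f g). Qed.

Lemma cont_comp (Y Z : topologicalType) (f : X -> Y) (g : Y -> Z) :
  {for x, continuous f} -> {for f x, continuous g} ->
  {for x, continuous (fun y => g (f y))}.
Proof. by move=> cf cg; exact: (@continuous_comp _ _ _ f g). Qed.

Lemma cont_pair (Y Z : topologicalType) (f : X -> Y) (g : X -> Z) :
  {for x, continuous f} -> {for x, continuous g} ->
  {for x, continuous (fun y => (f y, g y))}.
Proof.
by move=> cf cg; exact: (@cvg_pair _ _ _ (nbhs x) (nbhs (f x)) (nbhs (g x)) _ _ _ f g).
Qed.

Lemma cont_cst (Y : topologicalType) (y : Y) : {for x, continuous (fun _ : X => y)}.
Proof. exact: cst_continuous. Qed.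

Lemma cont_sum (I : Type) (s : seq I) (F : I -> X -> RR) :
  (forall i, {for x, continuous (F i)}) ->
  {for x, continuous (fun y => \sum_(i <- s) F i y)}.
Proof.
move=> cF; elim: s => [|i s IH].
  rewrite (_ : (fun _ => _) = fun=> 0); first exact: cont_cst.
  by apply/funext => y; rewrite big_nil.
rewrite (_ : (fun _ => _) = fun y => F i y + \sum_(j <- s) F j y); first exact: cont_add.
by apply/funext => y; rewrite big_cons.
Qed.

End pointwise.

Lemma cont_vsum (X : topologicalType) (V : normedModType RR) (x : X) (I : Type)
    (s : seq I) (F : I -> X -> V) :
  (forall i, {for x, continuous (F i)}) ->
  {for x, continuous (fun y => \sum_(i <- s) F i y)}.
Proof.
move=> cF; elim: s => [|i s IH].
  rewrite (_ : (fun _ => _) = fun=> 0); first exact: cont_cst.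
  by apply/funext => y; rewrite big_nil.
rewrite (_ : (fun _ => _) = fun y => F i y + \sum_(j <- s) F j y); first exact: cont_vadd.
by apply/funext => y; rewrite big_cons.
Qed.

(** * Euclidean norm, disks and cut-offs *)

Definition eucl (n : nat) (y : 'rV[RR]_n) : RR := Num.sqrt (sqnorm y).

Section eucl.
Variable n : nat.
Implicit Types y : 'rV[RR]_n.

Lemma sqnorm_ge0 y : 0 <= sqnorm y.
Proof. by apply: sumr_ge0 => i _; exact: sqr_ge0. Qed.

Lemma eucl_ge0 y : 0 <= eucl y.
Proof. exact: sqrtr_ge0. Qed.

Lemma euclZ c y : eucl (c *: y) = `|c| * eucl y.
Proof.
rewrite /eucl (_ : sqnorm (c *: y) = c ^+ 2 * sqnorm y).
  by rewrite sqrtrM ?sqr_ge0// sqrtr_sqr.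
by rewrite /sqnorm mulr_sumr; apply: eq_bigr => i _; rewrite mxE exprMn.
Qed.

Lemma norm_le_eucl y : `|y| <= eucl y.
Proof.
apply: row_norm_le; first exact: eucl_ge0.
move=> i; rewrite -sqrtr_sqr ler_sqrt ?sqnorm_ge0//.
by rewrite /sqnorm (bigD1 i)//= lerDl; apply: sumr_ge0 => j _; exact: sqr_ge0.
Qed.

Lemma sqnorm_continuous : continuous (@sqnorm n).
Proof.
move=> y; apply: cont_sum => i.
apply: (cont_comp (f := fun y : 'rV[RR]_n => y ord0 i) (g := fun z : RR => z ^+ 2)).
  exact: coord_continuous.
exact: exprn_continuous.
Qed.

Lemma eucl_continuous : continuous (@eucl n).
Proof.
move=> y; apply: continuous_comp; first exact: sqnorm_continuous.
exact: sqrt_continuous.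
Qed.

Lemma sqnormE y : sqnorm y = eucl y ^+ 2.
Proof. by rewrite sqr_sqrtr// sqnorm_ge0. Qed.

Lemma diskE y : disk n y = (eucl y <= 1).
Proof. by rewrite /disk /= sqnormE -{1}(expr1n _ 2) ler_pXn2r// ?nnegrE ?eucl_ge0. Qed.

Lemma open_diskE y : open_disk n y = (eucl y < 1).
Proof. by rewrite /open_disk /= sqnormE -{1}(expr1n _ 2) ltr_pXn2r// ?nnegrE ?eucl_ge0. Qed.

Lemma sphereE y : sphere n y <-> eucl y = 1.
Proof.
rewrite /sphere /= sqnormE; split=> [/eqP|->]; last by rewrite expr1n.
by rewrite sqrp_eq1 ?eucl_ge0// => /eqP.
Qed.

Lemma disk_closed : closed (disk n).
Proof.
rewrite (_ : disk n = @sqnorm n @^-1` [set x | x <= 1]).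
  by apply: preimage_closed; [move=> x _; exact: sqnorm_continuous|exact: closed_le].
by [].
Qed.

Lemma disk_compact : compact (disk n).
Proof.
apply: bounded_closed_compact; last exact: disk_closed.
exists 1; split=> // M M1 y; rewrite diskE => y1.
by rewrite /= (le_trans (norm_le_eucl y))// (le_trans y1)// ltW.
Qed.

End eucl.

(** The linear bound forces [g] to tend to [0] together with [tau]; formulas that divide by [tau]
    thereby extend by [0] across the set where [tau] is not positive. *)
Lemma cut_continuous (X : topologicalType) (V : normedModType RR) (K : RR)
    (tau : X -> RR) (g : X -> V) :
  continuous tau -> (forall x, 0 < tau x -> {for x, continuous g}) ->
  (forall x, 0 < tau x < 1 -> `|g x| <= K * tau x) ->
  continuous (fun x => if 0 < tau x then g x else 0).
Proof.
move=> ct cg gK x; have [tx|tx] := ltP 0 (tau x).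
  have nt : \forall y \near x, 0 < tau y.
    by apply: near_gt => //; exact: ct.
  rewrite /continuous_at tx; apply: cvg_trans (cg x tx).
  by apply: near_eq_cvg; apply: filterS nt => y ->.
apply/cvg_ballP => e e0; rewrite near_map ltNge tx /=.
pose d := Order.min 1 (e / (`|K| + 1)).
have K0 : 0 < `|K| + 1 by rewrite ltr_wpDl.
have d0 : 0 < d by rewrite lt_min ltr01 divr_gt0.
have : \forall y \near x, tau y < d.
  by apply: near_lt; [exact: ct|exact: le_lt_trans d0].
apply: filterS => y yd; rewrite -ball_normE /ball_ /= sub0r normrN.
case: ifPn => [ty|_]; last by rewrite normr0.
move: yd; rewrite lt_min => /andP[t1 te].
apply: (@le_lt_trans _ _ (K * tau y)); first by apply: gK; rewrite ty.
apply: (@le_lt_trans _ _ ((`|K| + 1) * tau y)).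
  by rewrite ler_wpM2r ?(ltW ty)// (le_trans (ler_norm _))// lerDl.
by rewrite mulrC -ltr_pdivlMr.
Qed.

Definition clamp (x : RR) : RR := Order.max 0 (Order.min 1 x).

Lemma clamp_continuous : continuous clamp.
Proof.
have c1 : continuous (fun x : RR => Order.min 1 x).
  move=> x; apply: (@continuous_min RR RR (fun=> 1) idfun x); [exact: cvg_cst|exact: cvg_id].
move=> x; exact: (@continuous_max RR RR (fun=> 0) _ x (cvg_cst _) (c1 x)).
Qed.

Lemma clamp_ge0 x : 0 <= clamp x.
Proof. by rewrite /clamp le_max lexx. Qed.

Lemma clamp_le1 x : clamp x <= 1.
Proof. by rewrite /clamp ge_max ler01 ge_min lexx. Qed.

Lemma clamp0 x : x <= 0 -> clamp x = 0.
Proof. by move=> x0; rewrite /clamp; case: (leP 1 x) => h1; case: leP => h2; lra. Qed.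

Lemma clamp1 x : 1 <= x -> clamp x = 1.
Proof. by move=> x1; rewrite /clamp; case: (leP 1 x) => h1; case: leP => h2; lra. Qed.

Lemma row_mx_continuous (X : topologicalType) m n (f : X -> 'rV[RR]_m)
    (g : X -> 'rV[RR]_n) :
  continuous f -> continuous g -> continuous (fun x => row_mx (f x) (g x)).
Proof.
move=> cf cg; apply: continuous_row => i x.
have coord k (h : X -> 'rV[RR]_k) j : continuous h -> {for x, continuous (fun x => h x ord0 j)}.
  move=> ch; apply: (@continuous_comp_fun _ _ _ h (fun v : 'rV_k => v ord0 j)) => //.
  exact: coord_continuous.
rewrite [X in continuous_at _ X](_ : _ = fun x => match fintype.split i with
    | inl j => f x ord0 j | inr j => g x ord0 j end).
  by case: (fintype.split i) => j; exact: coord.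
by apply/funext => z; rewrite mxE.
Qed.

(* Euclidean neighbourhood retract. *)
Record enr (L : topologicalType) (P : set L) := Enr {
  enr_dim : nat;
  enr_in : L -> 'rV[RR]_enr_dim;
  enr_dom : set 'rV[RR]_enr_dim;
  enr_ret : 'rV[RR]_enr_dim -> L;
  enr_in_continuous : {within P, continuous enr_in};
  enr_open : open enr_dom;
  enr_in_dom : forall x, P x -> enr_dom (enr_in x);
  enr_ret_continuous : forall w, enr_dom w -> {for w, continuous enr_ret};
  enr_ret_sub : forall w, enr_dom w -> P (enr_ret w);
  enr_inK : forall x, P x -> enr_ret (enr_in x) = x }.
Arguments enr_dom {L P} e _.
Arguments enr_ret {L P} e _.
Arguments enr_open {L P} e.

(** Lets the neighbourhood live in any retract [E] of a Euclidean space; attaching a cell uses a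
    product of three factors. *)
Lemma enr_transfer (L : topologicalType) (P : set L) (E : topologicalType) (M : nat)
    (a : E -> 'rV[RR]_M) (b : 'rV[RR]_M -> E) (i : L -> E) (O : set E) (r : E -> L) :
  continuous a -> continuous b -> cancel a b ->
  {within P, continuous i} -> open O -> (forall x, P x -> O (i x)) ->
  (forall w, O w -> {for w, continuous r}) -> (forall w, O w -> P (r w)) ->
  (forall x, P x -> r (i x) = x) -> enr P.
Proof.
move=> ca cb ab ci oO iO cr rP ri.
apply: (@Enr _ _ M (a \o i) (b @^-1` O) (r \o b)) => /=.
- by apply: (@within_comp _ _ _ _ setT) => //; exact: continuous_subspaceT.
- by apply: open_comp => // x _; exact: cb.
- by move=> x Px; rewrite ab; exact: iO.
- by move=> w Ow; apply: cont_comp; [exact: cb|exact: cr].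
- by move=> w; exact: rP.
- by move=> x Px; rewrite ab ri.
Qed.

(** * Attaching a cell to a Euclidean neighbourhood retract *)

Section attach.
Variables (L : topologicalType) (P0 : set L) (n : nat) (chi : 'rV[RR]_n -> L).
Hypothesis hL : hausdorff_space L.
Hypothesis kP0 : compact P0.
Hypothesis cchi : {within disk n, continuous chi}.
Hypothesis ichi : forall x y, open_disk n x -> open_disk n y -> chi x = chi y -> x = y.
Hypothesis chiP0 : forall y, open_disk n y -> ~ P0 (chi y).
Hypothesis chiS : forall y, sphere n y -> P0 (chi y).
Variable e0 : enr P0.

Local Notation N := (enr_dim e0).
Local Notation i0 := (enr_in e0).
Local Notation O0 := (enr_dom e0).
Local Notation r0 := (enr_ret e0).

Let hat (y : 'rV[RR]_n) := (eucl y)^-1 *: y.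

Let eucl_hat y : eucl y != 0 -> eucl (hat y) = 1.
Proof. by move=> y0; rewrite /hat euclZ ger0_norm ?invr_ge0 ?eucl_ge0// mulVf. Qed.

Let sub_disk y : sphere n y -> disk n y.
Proof. by move=> /sphereE y1; rewrite diskE y1. Qed.

(** On the outer half of the disk [alpha] depends on the direction only and takes values in the
    image of [P0] under [i0]; this collar is what lets the retraction slide points of the cell along
    rays. The inner half is filled in by Tietze extension. *)
Let ex_alpha : exists a : 'rV[RR]_n -> 'rV[RR]_N, continuous a /\
  forall y, 1 / 2 <= eucl y -> a y = i0 (chi (hat y)).
Proof.
pose A := [set y : 'rV[RR]_n | 1 / 2 <= eucl y].
have cA : closed A.
  apply: (@preimage_closed _ _ (@eucl n) [set x | 1 / 2 <= x]); last exact: closed_ge.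
  by move=> y _; exact: eucl_continuous.
have pA y : A y -> eucl y != 0.
  by rewrite /A /= => yA; apply/eqP => y0; move: yA; rewrite y0; lra.
have ci : {within sphere n, continuous (i0 \o chi)}.
  apply: (@within_comp _ _ _ _ P0) => //; last exact: enr_in_continuous.
  exact: continuous_subspaceW cchi.
have cf : {within A, continuous (fun y => i0 (chi (hat y)))}.
  apply: (@within_comp _ _ _ A (sphere n) hat (i0 \o chi)) => //.
    apply: continuous_in_subspaceT => y /set_mem Ay.
    apply: (cont_vscale (v := idfun)); last exact: cvg_id.
    by apply: cont_inv; [exact: pA|exact: eucl_continuous].
  by move=> y /pA y0; apply/sphereE; exact: eucl_hat.
have kS : compact (i0 @` P0).
  by apply: continuous_compact => //; exact: enr_in_continuous.
have [B [_ bB]] := compact_bounded kS.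
have bf y : A y -> `|i0 (chi (hat y))| <= `|B| + 1.
  move=> /pA y0; apply: bB; first by rewrite (le_lt_trans (ler_norm _))// ltrDl.
  by exists (chi (hat y)) => //; apply: chiS; apply/sphereE; exact: eucl_hat.
have nR : normal_space 'rV[RR]_n by exact: (@pseudometric_normal RR).
have [a [ca aE]] := tietze_row nR cA cf bf.
by exists a; split=> // y; exact: aE.
Qed.

Let alpha := projT1 (cid ex_alpha).
Let calpha : continuous alpha. Proof. by case: (projT2 (cid ex_alpha)). Qed.
Let alphaE y : 1 / 2 <= eucl y -> alpha y = i0 (chi (hat y)).
Proof. by case: (projT2 (cid ex_alpha)) => _; apply. Qed.

Let hat_sphere y : eucl y = 1 -> hat y = y.
Proof. by move=> y1; rewrite /hat y1 invr1 scale1r. Qed.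

Let E : topologicalType := ('rV[RR]_N * 'rV[RR]_n * RR)%type.

(** Embedding of the cell: the last coordinate is the height over [P0], zero on the sphere, and the
    middle one divided by the height gives back the point of the open disk. *)
Let J (y : 'rV[RR]_n) : E := (alpha y, (1 - eucl y) *: y, 1 - eucl y).

Let inv (x : L) : 'rV[RR]_n := xget 0 [set y | open_disk n y /\ chi y = x].

Let invK y : open_disk n y -> inv (chi y) = y.
Proof.
move=> oy; rewrite /inv; case: xgetP => [z _ [oz zy]|/(_ y)]; first exact: ichi.
by case.
Qed.

Let ii (x : L) : E := if `[< P0 x >] then (i0 x, 0, 0) else J (inv x).

Let P := P0 `|` chi @` disk n.

Let iiP0 x : P0 x -> ii x = (i0 x, 0, 0).
Proof. by rewrite /ii; case: asboolP. Qed.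

Let iichi y : disk n y -> ii (chi y) = J y.
Proof.
rewrite diskE le_eqVlt => /orP[/eqP y1|y1].
  have sy : sphere n y by apply/sphereE.
  rewrite iiP0; last exact: chiS.
  by rewrite /J alphaE ?hat_sphere// y1 ?subrr ?scale0r//; lra.
have oy : open_disk n y by rewrite open_diskE.
by rewrite /ii asboolF ?invK//; exact: chiP0.
Qed.

Let PE x : P x -> P0 x \/ exists2 y, open_disk n y & x = chi y.
Proof.
move=> [|[y Dy <-]]; first by left.
have [y1|y1] := ltP (eucl y) 1; first by right; exists y; rewrite ?open_diskE.
left; apply: chiS; apply/sphereE; apply/eqP; rewrite eq_le y1 andbT.
by rewrite -diskE.
Qed.

Let pair3C (X : topologicalType) (u : X -> 'rV[RR]_N) (v : X -> 'rV[RR]_n) (t : X -> RR) x :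
  {for x, continuous u} -> {for x, continuous v} -> {for x, continuous t} ->
  {for x, continuous (fun y => (u y, v y, t y) : E)}.
Proof. by move=> cu cv ct; exact: (cont_pair (cont_pair cu cv) ct). Qed.

Let cJ : continuous J.
Proof.
have c1 : continuous (fun y : 'rV[RR]_n => 1 - eucl y).
  by move=> y; apply: cont_sub; [exact: cont_cst|exact: eucl_continuous].
move=> y; apply: (pair3C (u := alpha) (v := fun y => (1 - eucl y) *: y) (t := fun y => 1 - eucl y)).
- exact: calpha.
- by apply: (cont_vscale (v := idfun)); [exact: c1|exact: cvg_id].
- exact: c1.
Qed.

Let hE : hausdorff_space E.
Proof. exact: (@norm_hausdorff _ ('rV[RR]_N * 'rV[RR]_n * RR^o)%type). Qed.

Let cP0 : closed P0. Proof. exact: compact_closed. Qed.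

Let kchiD : compact (chi @` disk n).
Proof. by apply: continuous_compact => //; exact: disk_compact. Qed.

Let kP : compact P. Proof. exact: compactU. Qed.

Let cP : closed P. Proof. exact: compact_closed. Qed.

Let cii : {within P, continuous ii}.
Proof.
apply: withinU_continuous => //; first exact: compact_closed.
  apply: (@within_eq _ _ _ (fun x => (i0 x, 0, 0) : E)).
    by move=> x /iiP0.
  apply: (@within_comp _ _ _ _ setT i0 (fun u => (u, 0, 0) : E)) => //.
    exact: enr_in_continuous.
  apply: continuous_subspaceT => u.
  apply: (pair3C (u := idfun) (v := fun=> 0) (t := fun=> 0)); [exact: cvg_id|exact: cont_cst|].
  exact: cont_cst.
apply: compact_quotient => //; [exact: disk_compact|exact: disk_closed|].
apply: (@within_eq _ _ _ J); first by move=> y /iichi.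
exact: continuous_subspaceT.
Qed.

Let iiI x x' : P x -> P x' -> ii x = ii x' -> x = x'.
Proof.
have d y : open_disk n y -> disk n y by rewrite open_diskE diskE => /ltW.
move=> /PE[P0x|[y oy ->]] /PE[P0x'|[y' oy' ->]].
- rewrite !iiP0// => -[xx'].
  by rewrite -(enr_inK e0 P0x) xx' enr_inK.
- rewrite iiP0// iichi; last exact: d.
  move=> [_ _ e]; exfalso; move: oy'; rewrite open_diskE; lra.
- rewrite (iiP0 P0x') iichi; last exact: d.
  move=> [_ _ e]; exfalso; move: oy; rewrite open_diskE; lra.
- rewrite !iichi; [|exact: d|exact: d] => -[_ e1 e2].
  have e3 : eucl y = eucl y' by lra.
  congr chi; move: e1; rewrite e3 => /(scalerI _); apply.
  by move: oy'; rewrite open_diskE subr_eq0 => /lt_eqF; rewrite eq_sym => ->.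
Qed.

Let jj (p : E) : L := xget (r0 p.1.1) [set x | P x /\ ii x = p].

Let jjK x : P x -> jj (ii x) = x.
Proof.
move=> Px; rewrite /jj; case: xgetP => [z _ [Pz zx]|/(_ x)]; first exact: iiI.
by case.
Qed.

Let uu (p : E) := p.1.1.
Let vv (p : E) := p.1.2.
Let tt (p : E) : RR := p.2.
(** At positive height, [yy] recovers the point of the disk and [rho] measures the deviation from
    the image of [J] relative to the height. As [rho] drops from [2] to [1], [ww] passes from [uu p]
    to [alpha (yy p)]. The new height [ss] vanishes for [rho >= 1] and is [1 - eucl (yy p)] for
    [rho <= 1/2]. Where [yy p] has norm at least [1/2], [zz] is the middle coordinate of [J] at
    height [ss p] in the direction of [yy p]; the maximum with [1/2] avoids a division by zero. *)
Let yy p := (tt p)^-1 *: vv p.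
Let rho p := (`|uu p - alpha (yy p)| + `|eucl (yy p) - 1 + tt p|) / tt p.
Let dw p := if 0 < tt p then (1 - clamp (rho p - 1)) *: (alpha (yy p) - uu p) else 0.
Let ww p := uu p + dw p.
Let ss p : RR := if 0 < tt p then clamp (2 - 2 * rho p) * (1 - eucl (yy p)) else 0.
Let zz p := if 0 < tt p then
  (ss p * (1 - ss p) / Order.max (eucl (yy p)) (1 / 2)) *: yy p else 0.
Let Ro p : E := (i0 (r0 (ww p)), zz p, ss p).

(** [Uo] surrounds [P0], and there [Ro] moves points onto the image of [ii]; [Ui] surrounds the open
    cell. On the overlap [rho < 1/2], so [Ro p] is [J (yy p)] and the two formulas for [rr] agree.
    With height below [1/6] and [rho < 1], the norm of [yy p] exceeds [1 - 2/6 = 2/3], well inside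
    the region where [alpha] is radial. *)
Let Uo : set E := [set p | tt p < 1 / 6 /\ O0 (ww p)].
Let Ui : set E := [set p | 0 < tt p /\ rho p < 1 / 2].
Let rr p := if tt p < 1 / 6 then jj (Ro p) else chi (yy p).

Let cuu : continuous uu.
Proof. by apply: (@continuous_comp_fun E _ _ fst fst) => p; exact: cvg_fst. Qed.
Let cvv : continuous vv.
Proof. by apply: (@continuous_comp_fun E _ _ fst snd) => p; [exact: cvg_fst|exact: cvg_snd]. Qed.
Let ctt : continuous tt.
Proof. by move=> p; exact: cvg_snd. Qed.

Let cyy p : 0 < tt p -> {for p, continuous yy}.
Proof.
move=> t0; apply: cont_vscale; last exact: cvv.
by apply: cont_inv; [rewrite gt_eqF|exact: ctt].
Qed.

Let ceyy p : 0 < tt p -> {for p, continuous (fun p => eucl (yy p))}.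
Proof. by move=> t0; apply: cont_comp; [exact: cyy|exact: eucl_continuous]. Qed.

Let cayy p : 0 < tt p -> {for p, continuous (fun p => alpha (yy p))}.
Proof. by move=> t0; apply: cont_comp; [exact: cyy|exact: calpha]. Qed.

Let crho p : 0 < tt p -> {for p, continuous rho}.
Proof.
move=> t0; apply: cont_mul; last by apply: cont_inv; [rewrite gt_eqF|exact: ctt].
apply: cont_add; [apply: cont_vnorm; apply: cont_vsub; [exact: cuu|exact: cayy]|].
apply: cont_abs; apply: cont_add; last exact: ctt.
by apply: cont_sub; [exact: ceyy|exact: cont_cst].
Qed.

Let rho_bounds p : 0 < tt p ->
  `|uu p - alpha (yy p)| <= rho p * tt p /\ `|eucl (yy p) - 1 + tt p| <= rho p * tt p.
Proof.
move=> t0; rewrite /rho divfK ?gt_eqF//; split; first by rewrite lerDl.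
by rewrite lerDr.
Qed.

Let cdw : continuous dw.
Proof.
apply: (@cut_continuous E 'rV[RR]_N 2 tt
  (fun p => (1 - clamp (rho p - 1)) *: (alpha (yy p) - uu p))); first exact: ctt.
  move=> p t0; apply: cont_vscale; last by apply: cont_vsub; [exact: cayy|exact: cuu].
  apply: cont_sub; first exact: cont_cst.
  apply: cont_comp; last exact: clamp_continuous.
  by apply: cont_sub; [exact: crho|exact: cont_cst].
move=> p /andP[t0 _]; rewrite normrZ (distrC (alpha _)).
have [r2|r2] := leP 2 (rho p).
  rewrite clamp1; last by lra.
  by rewrite subrr normr0 mul0r mulr_ge0 ?ltW.
have [b1 _] := rho_bounds t0.
apply: (@le_trans _ _ (rho p * tt p)); last by rewrite ler_wpM2r ?ltW.
apply: le_trans b1; rewrite ler_piMl// ger0_norm ?subr_ge0 ?clamp_le1//.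
by rewrite gerBl clamp_ge0.
Qed.

Let cww : continuous ww.
Proof. by move=> p; apply: cont_vadd; [exact: cuu|exact: cdw]. Qed.

Let css_bound p : 0 < tt p ->
  `|clamp (2 - 2 * rho p) * (1 - eucl (yy p))| <= 2 * tt p.
Proof.
move=> t0; rewrite normrM (ger0_norm (clamp_ge0 _)).
have [r1|r1] := ltP (rho p) 1; last first.
  by rewrite clamp0 ?mul0r; [rewrite mulr_ge0 ?ltW|lra].
have [_ b2] := rho_bounds t0.
apply: (@le_trans _ _ `|1 - eucl (yy p)|).
  by rewrite ler_piMl// clamp_le1.
have : rho p * tt p <= tt p by rewrite ler_piMl ?ltW.
move: b2; rewrite ler_norml => /andP[b2 b3] rt.
by rewrite ler_norml; apply/andP; split; lra.
Qed.

Let css : continuous ss.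
Proof.
apply: (@cut_continuous _ RR^o 2 _ (fun p => clamp (2 - 2 * rho p) * (1 - eucl (yy p)))) => //.
  move=> p t0; apply: cont_mul; last by apply: cont_sub; [exact: cont_cst|exact: ceyy].
  apply: cont_comp; last exact: clamp_continuous.
  apply: cont_sub; first exact: cont_cst.
  by apply: cont_mul; [exact: cont_cst|exact: crho].
by move=> p /andP[t0 _]; exact: css_bound.
Qed.

Let czz : continuous zz.
Proof.
apply: (@cut_continuous E 'rV[RR]_n 6 tt (fun p =>
  (ss p * (1 - ss p) / Order.max (eucl (yy p)) (1 / 2)) *: yy p)); first exact: ctt.
  move=> p t0; apply: cont_vscale; last exact: cyy.
  apply: cont_mul.
    apply: cont_mul; first exact: css.
    by apply: cont_sub; [exact: cont_cst|exact: css].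
  apply: cont_inv; last by apply: cont_max; [exact: ceyy|exact: cont_cst].
  by rewrite gt_eqF// lt_max; apply/orP; right; lra.
move=> p /andP[t0 t1]; rewrite normrZ.
have sb : `|ss p| <= 2 * tt p by rewrite /ss t0; exact: css_bound.
set m := Order.max _ _.
have m0 : 0 < m by rewrite lt_max; apply/orP; right; lra.
rewrite normrM -mulrA.
have -> : `|m^-1| * `|yy p| = `|yy p| / m by rewrite mulrC gtr0_norm ?invr_gt0.
have h1 : `|yy p| / m <= 1.
  by rewrite ler_pdivrMr// mul1r le_max norm_le_eucl.
have h0 : 0 <= `|yy p| / m by apply: divr_ge0; [exact: normr_ge0|exact: ltW].
apply: (@le_trans _ _ `|ss p * (1 - ss p)|); first by rewrite ler_piMr.
have h3 : `|1 - ss p| <= 3.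
  apply: (le_trans (ler_normB _ _)); rewrite normr1; lra.
rewrite normrM (_ : 6 * tt p = (2 * tt p) * 3); last by ring.
by apply: ler_pM.
Qed.

Let wwE p : 0 < tt p -> rho p <= 1 -> ww p = alpha (yy p).
Proof.
move=> t0 r1; rewrite /ww /dw t0 clamp0; last by lra.
by rewrite subr0 scale1r addrC subrK.
Qed.

Let yy_bounds p : 0 < tt p -> tt p < 1 / 6 -> rho p < 1 ->
  2 / 3 < eucl (yy p) /\ eucl (yy p) < 1.
Proof.
move=> t0 t1 r1; have [_] := rho_bounds t0.
have : rho p * tt p < tt p by rewrite gtr_pMl.
by rewrite ler_norml => rt /andP[b2 b3]; split; lra.
Qed.

Let i0r0alpha p : 0 < tt p -> tt p < 1 / 6 -> rho p < 1 ->
  i0 (r0 (alpha (yy p))) = alpha (yy p).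
Proof.
move=> t0 t1 r1; have [y1 y2] := yy_bounds t0 t1 r1.
rewrite alphaE; last by lra.
rewrite enr_inK//; apply: chiS; apply/sphereE; apply: eucl_hat.
by rewrite gt_eqF//; lra.
Qed.

Let RoP p : Uo p -> (ii @` P) (Ro p).
Proof.
move=> [t1 Ow]; have [t0|t0] := ltP 0 (tt p); last first.
  exists (r0 (ww p)); first by left; exact: enr_ret_sub.
  rewrite iiP0; last exact: enr_ret_sub.
  by rewrite /Ro /zz /ss ltNge t0.
have [r1|r1] := leP 1 (rho p).
  exists (r0 (ww p)); first by left; exact: enr_ret_sub.
  rewrite iiP0; last exact: enr_ret_sub.
  have s0 : ss p = 0 by rewrite /ss t0 clamp0 ?mul0r//; lra.
  by rewrite /Ro /zz t0 s0 !mul0r scale0r.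
have [y1 y2] := yy_bounds t0 t1 r1.
have e0' : eucl (yy p) != 0 by rewrite gt_eqF//; lra.
have [s0 s1] : 0 <= ss p /\ ss p < 1 / 3.
  rewrite /ss t0; have c0 := clamp_ge0 (2 - 2 * rho p).
  split; first by apply: mulr_ge0 => //; lra.
  have c1 := clamp_le1 (2 - 2 * rho p).
  apply: (@le_lt_trans _ _ (1 - eucl (yy p))); last by lra.
  by rewrite ler_piMl//; lra.
(* The point of the disk at height [ss p] in the direction of [yy p]. Its radius is more than [2/3],
   so [alpha] takes the same value at [y] as at [yy p]. *)
pose y := (1 - ss p) *: hat (yy p).
have ey : eucl y = 1 - ss p by rewrite euclZ eucl_hat// mulr1 ger0_norm//; lra.
have hy : hat y = hat (yy p).
  by rewrite {1}/hat ey /y scalerA mulVf ?scale1r// gt_eqF//; lra.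
have Dy : disk n y by rewrite diskE ey; lra.
exists (chi y); first by right; exists y.
rewrite iichi// /J /Ro wwE ?ltW// i0r0alpha// ey subKr; congr (_, _, _).
  by rewrite !alphaE ?hy ?ey//; lra.
rewrite /zz t0 max_l; last by lra.
by rewrite /y /hat !scalerA; congr (_ *: _); ring.
Qed.

Let rrUi p : Ui p -> disk n (yy p) /\ rr p = chi (yy p).
Proof.
move=> [t0 r1]; have [_ b2] := rho_bounds t0.
have y1 : eucl (yy p) < 1.
  have : rho p * tt p < 1 / 2 * tt p by rewrite ltr_pM2r.
  by move: b2; rewrite ler_norml => /andP[b2 b3] rt; lra.
have Dy : disk n (yy p) by rewrite diskE ltW.
split=> //; rewrite /rr; case: ifPn => // t1.
have r1' : rho p < 1 by lra.
have [y2 _] := yy_bounds t0 t1 r1'.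
rewrite (_ : Ro p = ii (chi (yy p))); first by apply: jjK; right; exists (yy p).
have se : ss p = 1 - eucl (yy p) by rewrite /ss t0 clamp1 ?mul1r//; lra.
rewrite iichi// /J /Ro wwE ?ltW// i0r0alpha// se; congr (_, _, _).
rewrite /zz t0 max_l; last by lra.
rewrite se subKr -mulrA mulfV ?mulr1// gt_eqF//; lra.
Qed.

Let oUo : open Uo.
Proof.
have -> : Uo = [set p | tt p < 1 / 6] `&` ww @^-1` O0 by [].
apply: openI; last by apply: open_comp => [x _|]; [exact: cww|exact: enr_open].
by rewrite openE => p tp; exact: (near_lt (f := tt) (ctt (x:=p)) tp).
Qed.

Let oUi : open Ui.
Proof.
rewrite openE => p [t0 rp]; apply: filterI; first exact: (near_gt (f := tt) (ctt (x:=p)) t0).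
exact: (near_lt (f := rho) (crho t0) rp).
Qed.

Let crrUo : {within Uo, continuous rr}.
Proof.
apply: (@within_eq _ _ _ (jj \o Ro)); first by move=> p [t1 _]; rewrite /rr t1.
apply: (@within_comp _ _ _ _ (ii @` P)) => //; last exact: compact_inverse.
have c1 : {within Uo, continuous (fun p => i0 (r0 (ww p)))}.
  apply: (@within_comp _ _ _ Uo P0 (r0 \o ww) i0) => //.
  - apply: (@within_comp _ _ _ Uo O0 ww r0).
    + exact: continuous_subspaceT.
    + by move=> p [].
    + by apply: continuous_in_subspaceT => w /set_mem; exact: enr_ret_continuous.
  - by move=> p [_ Ow]; exact: enr_ret_sub.
  - exact: enr_in_continuous.
apply: continuous_in_subspaceT => p /set_mem Up.
apply: (pair3C (u := fun p => i0 (r0 (ww p))) (v := zz) (t := ss)).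
- exact: (open_within oUo c1 Up).
- exact: czz.
- exact: css.
Qed.

Let crrUi : {within Ui, continuous rr}.
Proof.
apply: (@within_eq _ _ _ (chi \o yy)); first by move=> p /rrUi [].
apply: (@within_comp _ _ _ _ (disk n)) => //; last by move=> p /rrUi [].
by apply: continuous_in_subspaceT => p /set_mem [t0 _]; exact: cyy.
Qed.

Lemma enr_attach : enr (P0 `|` chi @` disk n).
Proof.
have cl a b : continuous (fun w : 'rV[RR]_(a + b) => lsubmx w).
  apply: continuous_row => i; 
    rewrite [X in continuous X](_ : _ = fun w : 'rV[RR]_(a + b) => w ord0 (lshift b i)).
    exact: coord_continuous.
  by apply/funext => w; rewrite mxE.
have cr a b : continuous (fun w : 'rV[RR]_(a + b) => rsubmx w).
  apply: continuous_row => i; 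
    rewrite [X in continuous X](_ : _ = fun w : 'rV[RR]_(a + b) => w ord0 (rshift a i)).
    exact: coord_continuous.
  by apply/funext => w; rewrite mxE.
apply: (@enr_transfer _ _ E (N + (n + 1))
  (fun p => row_mx (uu p) (row_mx (vv p) (const_mx (tt p))))
  (fun w => (lsubmx w, lsubmx (rsubmx w), rsubmx (rsubmx w) ord0 ord0))
  ii (Uo `|` Ui) rr).
- apply: row_mx_continuous => //; apply: row_mx_continuous => //.
  apply: continuous_row => i; rewrite (_ : (fun _ => _) = tt) => //.
  by apply/funext => w; rewrite mxE.
- move=> w; apply: pair3C; [exact: cl| |].
    by apply: (cont_comp (f := fun w => rsubmx w) (g := fun w => lsubmx w)); [exact: cr|exact: cl].
  apply: (cont_comp (f := fun w => rsubmx (rsubmx w)) (g := fun w : 'rV[RR]_1 => w ord0 ord0)).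
    by apply: (cont_comp (f := fun w => rsubmx w) (g := fun w => rsubmx w)); exact: cr.
  exact: coord_continuous.
- by move=> [[u v] t]; rewrite /uu /vv /tt /= row_mxKl row_mxKr row_mxKl row_mxKr mxE.
- exact: cii.
- exact: openU.
- move=> x /PE[P0x|[y oy ->]].
    left; rewrite iiP0//; split; rewrite /tt/=; first by lra.
    rewrite /ww /dw /tt /= ltxx addr0; exact: enr_in_dom.
  have y1 : eucl y < 1 by rewrite -open_diskE.
  right; rewrite iichi; last by rewrite diskE ltW.
  have t0 : 0 < tt (J y) by rewrite /tt /= subr_gt0.
  have yE : yy (J y) = y.
    by rewrite /yy /vv /tt /= scalerA mulVf ?scale1r// gt_eqF// subr_gt0.
  split=> //; rewrite /rho yE /uu /tt /= subrr normr0 add0r.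
  rewrite (_ : eucl y - 1 + (1 - eucl y) = 0) ?normr0 ?mul0r; [lra|ring].
- move=> w [Uw|Uw].
    exact: (open_within oUo crrUo Uw).
  exact: (open_within oUi crrUi Uw).
- move=> w [Uw|Uw]; last by have [Dy ->] := rrUi Uw; right; exists (yy w).
  by rewrite /rr Uw.1; have [x Px <-] := RoP Uw; rewrite jjK.
- move=> x Px.
  case: (PE Px) => [P0x|[y oy ->]].
    rewrite /rr iiP0// /tt /= ifT; last by lra.
    rewrite (_ : Ro _ = ii x) ?jjK// iiP0//.
    by rewrite /Ro /zz /ss /ww /dw /tt /uu /= ltxx addr0 enr_inK.
  have y1 : eucl y < 1 by rewrite -open_diskE.
  rewrite iichi; last by rewrite diskE ltW.
  have t0 : 0 < tt (J y) by rewrite /tt /= subr_gt0.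
  have yE : yy (J y) = y.
    by rewrite /yy /vv /tt /= scalerA mulVf ?scale1r// gt_eqF// subr_gt0.
  have UJ : Ui (J y).
    split=> //; rewrite /rho yE /uu /tt /= subrr normr0 add0r.
    rewrite (_ : eucl y - 1 + (1 - eucl y) = 0) ?normr0 ?mul0r; [lra|ring].
  by have [_ ->] := rrUi UJ; rewrite yE.
Qed.

End attach.

(** The induction hypothesis holds for every choice of the removed element, so a proof may pick it,
    for instance a cell of maximal dimension. *)
Lemma finite_set_remove_ind (T : choiceType) (Q : set T -> Prop) :
  (forall A, finite_set A -> (forall x, A x -> Q (A `\ x)) -> Q A) ->
  forall A, finite_set A -> Q A.
Proof.
move=> H A fA; have [n] := ubnP #|` fset_set A|.
elim: n => // n IH in A fA *; rewrite ltnS => An.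
apply: H => // x Ax; apply: IH; first exact: finite_setD.
apply: leq_trans An; rewrite fset_setD1//.
by rewrite [X in (_ < X)%N](cardfsD1 x) in_fset_set// mem_set// add1n ltnS.
Qed.

Lemma finite_set_argmax (T : Type) (A : set T) (f : T -> nat) :
  finite_set A -> A !=set0 -> exists2 x, A x & forall y, A y -> (f y <= f x)%N.
Proof.
move=> fA [a Aa].
have [s sA] := (finite_seqP _).1 (finite_image f fA).
have [||m Am mmax] := @ex_maxnP (fun n => `[< exists2 x, A x & f x = n >]) (\max_(i <- s) i).
- by exists (f a); apply/asboolP; exists a.
- move=> n /asboolP [x Ax <-]; apply: leq_bigmax_seq => //.
  have : [set` s] (f x) by rewrite -sA; exists x.
  by [].
move/asboolP : Am => [x Ax fx]; exists x => // y Ay; rewrite fx.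
by apply: mmax; apply/asboolP; exists y.
Qed.

(** * Finite subcomplexes of a CW complex *)

Section CW.
Variables (L : topologicalType) (W : cell_data L).
Hypothesis cwW : is_CW W.

Let hL : hausdorff_space L. Proof. by case: cwW. Qed.

Let chiC (i : cw_I W) : {within disk (cw_dim i), continuous (cw_char i)}.
Proof. by case: cwW => _ [+ _]; apply. Qed.

Let chiI (i : cw_I W) x y : open_disk (cw_dim i) x -> open_disk (cw_dim i) y ->
  cw_char i x = cw_char i y -> x = y.
Proof. by case: cwW => _ [_ [+ _]]; apply. Qed.

Let ocell_cover (x : L) : exists i : cw_I W, ocell i x.
Proof. by case: cwW => _ [_ [_ [_ [+ _]]]]; apply. Qed.

Let ocell_disj (i j : cw_I W) x : ocell i x -> ocell j x -> i = j.
Proof. by case: cwW => _ [_ [_ [_ [_ [+ _]]]]]; apply. Qed.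

Let ocell_bd (i : cw_I W) : exists J : set (cw_I W), finite_set J /\
  (forall j : cw_I W, J j -> (cw_dim j < cw_dim i)%N) /\
  cw_char i @` sphere (cw_dim i) `<=` \bigcup_(j in J) ocell j.
Proof. by case: cwW => _ [_ [_ [_ [_ [_ [+ _]]]]]]; apply. Qed.

Lemma ccell_compact (i : cw_I W) : compact (ccell i).
Proof. by apply: continuous_compact; [exact: chiC|exact: disk_compact]. Qed.

Lemma ocell_ccell (i : cw_I W) : ocell i `<=` ccell i.
Proof. by move=> x [y]; rewrite open_diskE => y1 <-; exists y => //; rewrite diskE ltW. Qed.

Lemma ccellE (i : cw_I W) :
  ccell i = ocell i `|` cw_char i @` sphere (cw_dim i).
Proof.
apply/seteqP; split=> [x [y]|x [/ocell_ccell//|[y /sphereE y1 <-]]].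
  rewrite diskE le_eqVlt => /orP[/eqP y1|y1] <-.
    by right; exists y => //; exact/sphereE.
  by left; exists y => //; rewrite open_diskE.
by exists y => //; rewrite diskE y1.
Qed.

(** A point of the disk is approached radially by points of the open disk. *)
Lemma ccell_closure (i : cw_I W) : ccell i `<=` closure (ocell i).
Proof.
move=> _ [y Dy <-] B nB.
have /subspace_continuousP/(_ _ Dy _ nB) := chiC (i := i).
rewrite /nbhs /= /within /= => nD.
have c1 : {for 1 : RR, continuous (fun c : RR => c *: y)}.
  by apply: (cont_vscale (f := idfun)); [exact: cvg_id|exact: cont_cst].
have : \forall c \near (1 : RR)^'-, disk (cw_dim i) (c *: y) -> B (cw_char i (c *: y)).
  apply: cvg_within.
  by apply: (c1 [set z | disk (cw_dim i) z -> B (cw_char i z)]); rewrite scale1r.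
move=> n1.
have n2 : \forall c \near (1 : RR)^'-, 0 < c < 1.
  near=> c; apply/andP; split; last by near: c; exact: nbhs_left_lt.
  by near: c; apply: nbhs_left_gt; exact: ltr01.
have [c [cB /andP[c0 cl]]] := @filter_ex _ _ _ _ (filterI n1 n2).
have oc : eucl (c *: y) < 1.
  rewrite euclZ gtr0_norm//; move: Dy; rewrite diskE => y1.
  apply: le_lt_trans cl; rewrite ler_piMr// ltW//.
exists (cw_char i (c *: y)); split; first by exists (c *: y); rewrite ?open_diskE.
by apply: cB; rewrite diskE ltW.
Unshelve. all: by end_near. Qed.

Lemma subcomplex_ccell (J : set (cw_I W)) (j : cw_I W) :
  subcomplex J -> J j -> ccell j `<=` cells_union J.
Proof.
move=> cJ Jj; rewrite ((closure_id _).1 cJ).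
by apply: subset_trans (@ccell_closure j) _; apply: closureS => x ox; exists j.
Qed.

Lemma cells_union_mem (J : set (cw_I W)) (j : cw_I W) x :
  cells_union J x -> ocell j x -> J j.
Proof. by move=> [k Jk ok] oj; rewrite (ocell_disj oj ok). Qed.

Lemma finite_ccell_compact (J : set (cw_I W)) : finite_set J ->
  compact (\bigcup_(j in J) ccell j).
Proof.
apply: (@finite_set_remove_ind {classic cw_I W}
  (fun J => compact (\bigcup_(j in J) ccell (j : cw_I W)))) => A fA IH.
have [[x Ax]|A0] := pselect (A !=set0); last first.
  have -> : A = set0 by apply/eqP/negPn/negP => /set0P.
  by rewrite bigcup_set0; exact: compact0.
rewrite -(setD1K Ax) bigcup_setU1; apply: compactU; last exact: IH.
exact: (@ccell_compact (x : cw_I W)).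
Qed.

Lemma ccells_subcomplex (J : set (cw_I W)) : finite_set J ->
  (forall j, J j -> ccell j `<=` cells_union J) -> subcomplex J.
Proof.
move=> fJ H; rewrite /subcomplex.
have -> : cells_union J = \bigcup_(j in J) ccell j.
  apply/seteqP; split=> x [j Jj]; first by move/ocell_ccell; exists j.
  by move/H; apply.
by apply: compact_closed => //; exact: finite_ccell_compact.
Qed.

Lemma cells_union_compact (J : set (cw_I W)) : finite_set J -> subcomplex J ->
  compact (cells_union J).
Proof.
move=> fJ sJ; have -> : cells_union J = \bigcup_(j in J) ccell j.
  apply/seteqP; split=> x [j Jj]; first by move/ocell_ccell; exists j.
  exact: subcomplex_ccell.
exact: finite_ccell_compact.
Qed.

Definition finite_subcomplex (J : set (cw_I W)) := finite_set J /\ subcomplex J.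

Lemma finite_subcomplexU (J J' : set (cw_I W)) :
  finite_subcomplex J -> finite_subcomplex J' -> finite_subcomplex (J `|` J').
Proof.
move=> [fJ sJ] [fJ' sJ']; split; first by rewrite finite_setU.
by rewrite /subcomplex /cells_union bigcup_setU; exact: closedU.
Qed.

Lemma finite_subcomplex0 : finite_subcomplex set0.
Proof.
split; first exact: finite_set0.
by rewrite /subcomplex /cells_union bigcup_set0; exact: closed0.
Qed.

Lemma finite_subcomplex_bigcup (I : Type) (A : set I) (J : I -> set (cw_I W)) :
  finite_set A -> (forall i, A i -> finite_subcomplex (J i)) ->
  finite_subcomplex (\bigcup_(i in A) J i).
Proof.
move: A; apply: (@finite_set_remove_ind {classic I} (fun A =>
  (forall i : I, A i -> finite_subcomplex (J i)) ->
  finite_subcomplex (\bigcup_(i in A) J (i : I)))) => A fA IH AJ.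
have [[x Ax]|A0] := pselect (A !=set0); last first.
  have -> : A = set0 by apply/eqP/negPn/negP => /set0P.
  by rewrite bigcup_set0; exact: finite_subcomplex0.
rewrite -(setD1K Ax) bigcup_setU1; apply: finite_subcomplexU; first exact: AJ.
by apply: IH => // i [Ai _]; exact: AJ.
Qed.

(** Induction on the dimension: the finitely many cells that the boundary meets lie in finite
    subcomplexes, and the union of these stays closed when the cell is added. *)
Lemma finite_subcomplex_cell (i : cw_I W) :
  exists2 J, finite_subcomplex J & J i.
Proof.
have [n] := ubnP (cw_dim i); elim: n => // n IH in i *; rewrite ltnS => ni.
have [B [fB [Bd Bs]]] := ocell_bd i.
have ex j : exists J, B j -> finite_subcomplex J /\ J j.
  have [Bj|nBj] := pselect (B j); last by exists set0.
  have [J fJ Jj] := IH j (leq_trans (Bd _ Bj) ni).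
  by exists J.
have [F FP] := choice ex.
exists (i |` \bigcup_(j in B) F j); last by left.
have [fU sU] : finite_subcomplex (\bigcup_(j in B) F j).
  by apply: finite_subcomplex_bigcup => // j Bj; case: (FP j Bj).
split; first by rewrite finite_setU; split=> //; exact: finite_set1.
have E : cells_union (i |` \bigcup_(j in B) F j) =
    ocell i `|` cells_union (\bigcup_(j in B) F j).
  by rewrite /cells_union bigcup_setU1.
apply: ccells_subcomplex.
  by rewrite finite_setU; split=> //; exact: finite_set1.
move=> j [->|Fj]; rewrite E.
  rewrite ccellE; apply: setUS => x /Bs [k Bk okx].
  exists k => //; exists k => //; by case: (FP k Bk).
by apply: subset_trans (subcomplex_ccell sU Fj) _ => x; right.
Qed.

Lemma finite_subcomplex_cover (I : set (cw_I W)) : finite_set I ->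
  exists2 J, finite_subcomplex J & I `<=` J.
Proof.
move=> fI; have ex i : exists J, finite_subcomplex J /\ J i.
  by have [J] := finite_subcomplex_cell i; exists J.
have [F FP] := choice ex.
exists (\bigcup_(i in I) F i); first by apply: finite_subcomplex_bigcup => // i _; case: (FP i).
by move=> i Ii; exists i => //; case: (FP i).
Qed.

(** A neighbourhood that meets finitely many cells lies in every subcomplex containing these cells;
    this is why [K] ends up in the interior and not merely in the subcomplex. *)
Lemma compact_sub_subcomplex (K : set L) : CW_locally_finite W -> compact K ->
  exists2 J, finite_subcomplex J & K `<=` (cells_union J)°.
Proof.
move=> lf cK.
have ex x : exists N : set L, [/\ open N, N x & finite_set [set i : cw_I W | N `&` ocell i !=set0]].
  have [N [nN fN]] := lf x; exists N°; split; [exact: open_interior|exact: nN|].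
  apply: sub_finite_set fN => i [y [/interior_subset Ny oy]]; by exists y.
have [N NP] := choice ex.
have [|s _ sN] := @compact_finite_net _ _ N cK.
  by move=> x _; have [oN Nx _] := NP x; exact: open_nbhs_nbhs.
have [|J fJ IJ] := @finite_subcomplex_cover
    (\bigcup_(x in [set` s]) [set i : cw_I W | N x `&` ocell i !=set0]).
  by apply: bigcup_finite => // x _; case: (NP x).
exists J => // x /sN [y ys Nyx]; have [oN _ _] := NP y.
rewrite /interior nbhsE; exists (N y) => // z Nyz.
have [i oi] := ocell_cover z; exists i => //; apply: IJ; exists y => //.
by exists z.
Qed.

(** A cell of maximal dimension is removed. Boundaries consist of points in cells of smaller
    dimension and so avoid it; hence the rest is a subcomplex, and [enr_attach] puts the cell back.
    The point [x0] supplies a value for the retraction of the empty subcomplex. *)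
Lemma finite_subcomplex_enr (J : set (cw_I W)) (x0 : L) :
  finite_subcomplex J -> inhabited (enr (cells_union J)).
Proof.
move=> [fJ]; move: J fJ.
apply: (@finite_set_remove_ind {classic cw_I W} (fun J =>
  subcomplex (J : set (cw_I W)) -> inhabited (enr (cells_union (J : set (cw_I W)))))).
move=> J fJ IH sJ.
have [J0|nJ0] := pselect (J !=set0); last first.
  have -> : J = set0 by apply/eqP/negPn/negP => /set0P.
  rewrite /cells_union bigcup_set0; constructor.
  by apply: (@Enr _ _ 0%N (fun=> 0) set0 (fun=> x0)) => //;
    exact: continuous_subspace0.
have [i Ji imax] := finite_set_argmax (fun j : cw_I W => cw_dim j) fJ J0.
pose J' : set (cw_I W) := J `\ i.
have bd j : J j -> cw_char j @` sphere (cw_dim j) `<=` cells_union J'.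
  move=> Jj x sx; have [B [_ [Bd /(_ _ sx) [k Bk okx]]]] := ocell_bd j.
  exists k => //; split.
    apply: (@cells_union_mem J _ x) => //.
    by apply: (subcomplex_ccell sJ Jj); rewrite ccellE; right.
  by move=> ki; have := Bd _ Bk; rewrite ki ltnNge imax.
have fJ' : finite_set J' by exact: finite_setD.
have sJ' : subcomplex J'.
  apply: ccells_subcomplex => // j J'j; rewrite ccellE => x [ox|]; first by exists j.
  by apply: bd; case: J'j.
have [e0] := IH i Ji sJ'.
have E : cells_union J = cells_union J' `|` ccell i.
  rewrite /cells_union -{1}(setD1K Ji) bigcup_setU1 ccellE.
  apply/seteqP; split=> x.
    by move=> [oi|Jx]; [right; left|left].
  by move=> [Jx|[oi|/(bd _ Ji) Jx]]; [right|left|right].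
constructor; rewrite E; apply: enr_attach => //.
- exact: cells_union_compact.
- exact: chiI.
- move=> y oy H.
  have [_ ni] : J' i by apply: cells_union_mem H _; exists y.
  exact: (ni erefl).
- by move=> y sy; apply: (bd _ Ji); exists y.
Qed.

End CW.

(** Turns an approximate solution [Y] into an exact extension. The Urysohn function [l] runs from
    [0] on [A] to [1] outside [U], so the retracted segment starts at [r (F x)] on [A] and has
    become [Y x] before [N] is left. *)
Lemma patch (X L : topologicalType) (M : nat) (O : set 'rV[RR]_M)
    (r : 'rV[RR]_M -> L) (F g : X -> 'rV[RR]_M) (Y : X -> L) (A U N : set X) :
  normal_space X -> closed A -> open U -> closed N -> A `<=` U -> U `<=` N ->
  (forall w, O w -> {for w, continuous r}) ->
  continuous F -> continuous g -> continuous Y ->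
  (forall x s, N x -> 0 <= s <= 1 -> O ((1 - s) *: F x + s *: g x)) ->
  (forall x, N x -> Y x = r (g x)) ->
  exists h : X -> L, [/\ continuous h, forall x, A x -> h x = r (F x),
    forall x, ~ N x -> h x = Y x & forall x, N x -> exists2 w, O w & h x = r w].
Proof.
move=> nX cA oU cN AU UN cr cF cg cY FgO Yr.
have [l [cl l0 l1 l01]] : exists f : X -> RR, [/\ continuous f,
    (forall x, A x -> f x = 0), (forall x, (~` U) x -> f x = 1) & forall x, 0 <= f x <= 1].
  apply: urysohn01 => //; first exact: open_closedC.
  by apply/disjoints_subset; rewrite setCK.
pose G x := (1 - l x) *: F x + l x *: g x.
exists (fun x => if `[< N x >] then r (G x) else Y x); split.
- apply: (paste_continuous (B := ~` U)) => //; first exact: open_closedC.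
  + by move=> x; have [Ux|nUx] := pselect (U x); [left; exact: UN|right].
  + apply: (@within_comp _ _ _ N O G r); last 2 first.
    * by move=> x Nx; exact: FgO.
    * by apply: continuous_in_subspaceT => w /set_mem; exact: cr.
    apply: continuous_subspaceT => x.
    apply: (cont_vadd (V := 'rV[RR]_M) (u := fun x => (1 - l x) *: F x)
      (v := fun x => l x *: g x)); last by apply: cont_vscale; [exact: cl|exact: cg].
    by apply: cont_vscale; [apply: cont_sub; [exact: cont_cst|exact: cl]|exact: cF].
  + exact: continuous_subspaceT.
  + by move=> x Nx nUx; rewrite /G l1// subrr scale0r add0r scale1r -Yr.
- move=> x Ax; rewrite asboolT; last exact/UN/AU.
  by rewrite /G l0// subr0 scale1r scale0r addr0.
- by move=> x nN; rewrite asboolF.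
- by move=> x Nx; rewrite asboolT//; exists (G x) => //; exact: FgO.
Qed.

(** * Thickenings of compact sets *)

Section thickening.
Variables (M : nat) (K : set 'rV[RR]_M).
Hypothesis kK : compact K.

Lemma compact_thickening (O : set 'rV[RR]_M) : open O -> K `<=` O ->
  exists2 d : RR, 0 < d & forall p w, K p -> `|w - p| <= d -> O w.
Proof.
move=> oO KO; have /compact_near_coveringP := kK.
move=> /(_ _ (0 : RR)^'+ (fun d p => forall w, `|w - p| <= d -> O w) _) [p Kp|].
  have /nbhs_ballP [e /= e0 eO] : nbhs p O by apply: open_nbhs_nbhs; split=> //; exact: KO.
  exists (ball p (e / 2), [set d | d < e / 2]) => /=.
    by split; [apply: nbhsx_ballx; rewrite divr_gt0|apply: nbhs_right_lt; rewrite divr_gt0].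
  move=> [z d] [/= zp de] w wz; apply: eO; move: zp; rewrite -!ball_normE /= => zp.
  have := ler_distD z p w; rewrite (distrC z w); lra.
move=> d /= d0 H; exists (d / 2); first by rewrite divr_gt0.
move=> p w Kp; apply: (H (d / 2)) => //=; last by rewrite divr_gt0.
by rewrite sub0r normrN gtr0_norm ?divr_gt0//; lra.
Qed.

Lemma thickening_closed (d : RR) :
  closed [set w | exists2 p, K p & `|w - p| <= d].
Proof.
rewrite -openC openE => w nw.
suff H : \forall z \near w, K `<=` [set p | d < `|z - p|].
  by apply: filterS H => z H [p Kp]; have := H _ Kp => /=; rewrite ltNge => /negP.
apply: ((compact_near_coveringP _).1 kK _ (nbhs w) (fun w p => d < `|w - p|)) => p Kp.
have dp : d < `|w - p| by rewrite ltNge; apply/negP => pd; apply: nw; exists p.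
have c : {for (p, w), continuous (fun z : 'rV[RR]_M * 'rV[RR]_M => `|z.2 - z.1|)}.
  by apply: cont_vnorm; apply: cont_vsub; [exact: cvg_snd|exact: cvg_fst].
exact: (near_gt (f := fun z : 'rV[RR]_M * 'rV[RR]_M => `|z.2 - z.1|) c dp).
Qed.

Lemma compact_tuple_net (d : RR) : 0 < d -> exists k (x : 'I_k -> 'rV[RR]_M),
  (forall j, K (x j)) /\ forall p, K p -> exists j, `|p - x j| < d.
Proof.
move=> d0.
have [|s sK Ks] := @compact_finite_net _ K (fun x => ball x d) kK.
  by move=> x _; exact: nbhsx_ballx.
exists (size s), (fun j => tnth (in_tuple s) j); split.
  by move=> j; apply: sK; exact: mem_tnth.
move=> p /Ks [y ys]; rewrite -ball_normE /= => yp.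
have /tnthP [j yj] : y \in in_tuple s by [].
by exists j; rewrite -yj distrC.
Qed.

End thickening.

Lemma compact_set_type (X : topologicalType) (A : set X) :
  compact A -> compact [set: A].
Proof.
move=> cA F PF _.
have PG : ProperFilter (set_val @ F) by exact: fmap_proper_filter.
have FA : (set_val @ F) A.
  by rewrite /= /nbhs /=; apply: filterS filterT => x _; exact: set_valP.
have [x [Ax clx]] := cA _ PG FA.
exists (exist _ x (mem_set Ax)); split=> // B D FB [_ [/= [V oV <-] Vx VD]].
have [||y [[z Bz <-] Vz]] := clx [set set_val z | z in B] V.
- by rewrite /nbhs /=; apply: filterS FB => z Bz; exists z.
- by apply: open_nbhs_nbhs; split=> //; move: Vx; rewrite /= set_valE.
by exists z; split=> //; apply: VD.
Qed.

(* [T] is the adjunction space obtained from [C] and [X] by identifying [x] with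
   [e x] whenever [theta x = 0], realised inside [C * R] as the union of [C * {0}]
   and the graph of [theta] over [e]. *)
Lemma pushout (X C : topologicalType) (e : X -> C) (theta : X -> RR) :
  metrizable_compactum X -> metrizable_compactum C -> continuous e ->
  injective e -> continuous theta ->
  exists (T : topologicalType) (a : C -> T) (b : X -> T),
  [/\ metrizable_compactum T, continuous a, continuous b,
      (forall t, (exists c, t = a c) \/ (exists x, t = b x)) &
      (forall x, theta x = 0 -> a (e x) = b x) /\
      forall (S : topologicalType) (g1 : C -> S) (g2 : X -> S),
        continuous g1 -> continuous g2 ->
        (forall x, theta x = 0 -> g1 (e x) = g2 x) ->
        exists g : T -> S, [/\ continuous g, forall c, g (a c) = g1 c &
          forall x, g (b x) = g2 x]].
Proof.
move=> [cX mX] cmC ce ie ct; have [cC mC] := cmC.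
pose a0 c : C * RR := (c, 0); pose b0 x : C * RR := (e x, theta x).
have ca0 : continuous a0.
  by move=> c; apply: (cont_pair (f := idfun)); [exact: cvg_id|exact: cont_cst].
have cb0 : continuous b0 by move=> x; apply: cont_pair; [exact: ce|exact: ct].
pose A : set (C * RR) := range a0 `|` range b0.
have aA c : A (a0 c) by left; exists c.
have bA x : A (b0 x) by right; exists x.
have cA : compact A.
  by apply: compactU; apply: continuous_compact => //; exact: continuous_subspaceT.
pose T : topologicalType := A.
have vC : continuous (set_val : T -> C * RR) by exact: initial_continuous.
have cT : compact [set: T] by exact: compact_set_type.
pose a c : T := exist _ (a0 c) (mem_set (aA c)).
pose b x : T := exist _ (b0 x) (mem_set (bA x)).
have ca : continuous a by apply: continuous_comp_initial; exact: ca0.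
have cb : continuous b by apply: continuous_comp_initial; exact: cb0.
have [phi [cphi _ sphi]] := metrizable_compactum_separating cmC.
have vI (t t' : T) : set_val t = set_val t' -> t = t'.
  by rewrite set_valE => tt'; apply: val_inj.
have mT : metrizable T.
  apply: (@separating_metrizable T (fun k t => match k with
    | 0 => (set_val t).2 | k.+1 => phi k (set_val t).1 end)) => //.
    case=> [|k].
      by apply: (continuous_comp_fun (f := set_val) (g := snd)) => // x; exact: cvg_snd.
    apply: (continuous_comp_fun (f := fun t : T => (set_val t).1)) => //.
    by apply: (continuous_comp_fun (f := set_val) (g := fst)) => // x; exact: cvg_fst.
  move=> t t' H; apply: vI; rewrite [LHS]surjective_pairing [RHS]surjective_pairing.
  congr (_, _); last exact: (H 0%N).
  by apply: sphi => k; exact: (H k.+1).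
have hT : hausdorff_space T by exact: metrizable_hausdorff.
have cover t : (exists c, t = a c) \/ (exists x, t = b x).
  have := set_valP t => -[[c _ ct']|[x _ xt]]; [left; exists c|right; exists x];
  by apply: vI; rewrite set_valE.
exists T, a, b; split=> //; split.
  by move=> x x0; apply: vI; rewrite !set_valE /= /a0 /b0 x0.
move=> S g1 g2 cg1 cg2 g12.
have ex t : exists s : S, (forall c, t = a c -> s = g1 c) /\
    (forall x, t = b x -> s = g2 x).
  have [[c tc]|nc] := pselect (exists c, t = a c).
    exists (g1 c); split=> [c'|x]; rewrite tc => /(congr1 set_val); rewrite !set_valE /=.
      by move=> [->].
    by move=> [-> /esym x0]; exact: g12.
  case: (cover t) => [//|[x tx]].
  exists (g2 x); split=> [c tc|x']; first by exfalso; apply: nc; exists c.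
  by rewrite tx => /(congr1 set_val); rewrite !set_valE /= => -[/ie ->].
have [g gP] := choice ex.
exists g; split=> [|c|x]; [|exact: (gP _).1 c erefl|exact: (gP _).2 x erefl].
apply/continuous_subspace_setT.
have -> : [set: T] = range a `|` range b.
  by apply/seteqP; split=> // t _; case: (cover t) => -[y ->]; [left|right]; exists y.
apply: withinU_continuous.
- by apply: compact_closed => //; apply: continuous_compact => //; exact: continuous_subspaceT.
- by apply: compact_closed => //; apply: continuous_compact => //; exact: continuous_subspaceT.
- apply: compact_quotient => //; [exact: continuous_subspaceT|].
  apply: (@within_eq _ _ _ g1); last exact: continuous_subspaceT.
  by move=> c _; rewrite /= ((gP _).1 c erefl).
- apply: compact_quotient => //; [exact: continuous_subspaceT|].
  apply: (@within_eq _ _ _ g2); last exact: continuous_subspaceT.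
  by move=> x _; rewrite /= ((gP _).2 x erefl).
Qed.

(** The map is extended over [C] first. On [X] the prescribed values are then the given ones over
    [A] and, where [theta] vanishes, those of the extension just found; the two extensions descend
    to [T]. *)
Lemma pushout_edim (X C T L : topologicalType) (e : X -> C) (theta : X -> RR)
    (a : C -> T) (b : X -> T) (l0 : L) :
  continuous e -> continuous theta -> continuous a -> continuous b ->
  (forall t, (exists c, t = a c) \/ (exists x, t = b x)) ->
  (forall x, theta x = 0 -> a (e x) = b x) ->
  (forall (S : topologicalType) (g1 : C -> S) (g2 : X -> S),
        continuous g1 -> continuous g2 ->
        (forall x, theta x = 0 -> g1 (e x) = g2 x) ->
        exists g : T -> S, [/\ continuous g, forall c, g (a c) = g1 c &
          forall x, g (b x) = g2 x]) ->
  edim_le X L -> edim_le C L -> edim_le T L.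
Proof.
move=> ce ct ca cb cov ab univ [_ eX] [_ eC]; split; first by left; exists l0.
move=> A f cA cf.
have [g1 [cg1 g1f]] : exists g1 : C -> L,
    continuous g1 /\ forall c, (a @^-1` A) c -> g1 c = f (a c).
  apply: eC; first by apply: preimage_closed => // c _; exact: ca.
  by apply: (within_comp (B := A)) => //; exact: continuous_subspaceT.
pose Y := [set x | theta x = 0].
have cY : closed Y.
  apply: (@preimage_closed _ _ theta [set x | x = 0]); last exact: closed_eq.
  by move=> x _; exact: ct.
have cbA : closed (b @^-1` A) by apply: preimage_closed => // c _; exact: cb.
have [g2 [cg2 g2f]] : exists g2 : X -> L, continuous g2 /\
    forall x, (b @^-1` A `|` Y) x -> g2 x = if `[< (b @^-1` A) x >] then f (b x) else g1 (e x).
  apply: eX; first exact: closedU.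
  apply: (paste_within (f := f \o b) (g := g1 \o e)) => //.
  - by apply: (within_comp (B := A)) => //; exact: continuous_subspaceT.
  - by apply: continuous_subspaceT; exact: continuous_comp_fun.
  - by move=> x Ax Yx /=; rewrite g1f /=; rewrite ab.
have [g [cg ga gb]] := univ _ g1 g2 cg1 cg2 (fun x (x0 : theta x = 0) =>
  ltac:(rewrite g2f; [case: asboolP => //= Ax; rewrite -ab// g1f//= ab//|by right])).
exists g; split=> // t; case: (cov t) => [[c ->]|[x ->]] At.
  by rewrite ga g1f.
by rewrite gb g2f; [rewrite asboolT|left].
Qed.

(** * Universal compacta over families of faces of a simplex *)

Lemma cont_prod (X : topologicalType) (x : X) (I : Type) (s : seq I) (P : pred I)
    (F : I -> X -> RR) :
  (forall i, {for x, continuous (F i)}) ->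
  {for x, continuous (fun y => \prod_(i <- s | P i) F i y)}.
Proof.
move=> cF; elim: s => [|i s IH].
  rewrite (_ : (fun _ => _) = fun=> 1); first exact: cont_cst.
  by apply/funext => y; rewrite big_nil.
rewrite (_ : (fun _ => _) = fun y => (if P i then F i y else 1) * \prod_(j <- s | P j) F j y).
  by apply: cont_mul => //; case: (P i) => //; exact: cont_cst.
by apply/funext => y; rewrite big_cons; case: ifP; rewrite ?mul1r.
Qed.

Lemma cont_sum_cond (X : topologicalType) (x : X) (I : Type) (s : seq I) (P : pred I)
    (F : I -> X -> RR) :
  (forall i, {for x, continuous (F i)}) ->
  {for x, continuous (fun y => \sum_(i <- s | P i) F i y)}.
Proof.
move=> cF; rewrite (_ : (fun _ => _) = fun y => \sum_(i <- s) if P i then F i y else 0).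
  by apply: cont_sum => i; case: (P i) => //; exact: cont_cst.
by apply/funext => y; rewrite big_mkcond.
Qed.

Lemma preimage_eq0_closed (X : topologicalType) (f : X -> RR) :
  continuous f -> closed [set x | f x = 0].
Proof.
move=> cf; apply: (@preimage_closed _ _ f [set x | x = 0]); last exact: closed_eq.
by move=> x _; exact: cf.
Qed.

(* [K] plays the role of the union of those faces of the simplex on ['I_k] that
   belong to [F]: the weights [mu] are barycentric coordinates, and every map of a
   space of extension dimension at most [L] into that union of faces lifts to [K]
   up to a motion inside the faces. *)
Definition universal_for_faces (L : topologicalType) (k : nat)
    (F : {set {set 'I_k}}) : Prop :=
  exists (K : topologicalType) (mu : 'I_k -> K -> RR),
    [/\ metrizable_compactum K, edim_le K L,
        [/\ forall j, continuous (mu j), forall j x, 0 <= mu j x &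
          forall x, 1 <= \sum_j mu j x] &
        forall Z : topologicalType, polish Z -> edim_le Z L ->
        forall (A : set Z) (la : 'I_k -> Z -> RR), closed A ->
          (forall j, continuous (la j)) ->
          (forall z, A z -> [set j | la j z != 0]%SET \in F) ->
          exists q : Z -> K, {within A, continuous q} /\
            forall z j, A z -> la j z = 0 -> mu j (q z) = 0].

Lemma edim_point (L : topologicalType) (l0 : L) : edim_le 'rV[RR]_0 L.
Proof.
split; first by left; exists l0.
move=> A f _ _; exists (fun=> f 0); split; first exact: cst_continuous.
by move=> x _; rewrite (_ : x = 0)//; apply/rowP => -[].
Qed.

(** With no face allowed the set to be lifted is empty, so a single point with all weights [1] will
    do; ['rV[RR]_0] is the one-point space. *)
Lemma universal_for_no_face (L : topologicalType) (l0 : L) (k : nat) (j0 : 'I_k) :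
  universal_for_faces L (finset.set0 : {set {set 'I_k}}).
Proof.
have E : [set: 'rV[RR]_0] = [set 0].
  by apply/seteqP; split=> x // _; apply/rowP => -[].
have cT : compact [set: 'rV[RR]_0] by rewrite E; exact: compact_set1.
exists 'rV[RR]_0, (fun _ _ => 1); split.
- split=> //; apply: (@separating_metrizable _ (fun _ _ => 0)) => //.
    by move=> _; exact: cst_continuous.
  by move=> x y _; apply/rowP => -[].
- exact: edim_point.
- split=> [_|//|_]; first exact: cst_continuous.
  by rewrite sumr_const card_ord ler1n; case: k j0 => [[]|].
- move=> Z _ _ A la _ _ H; exists (fun=> 0); split.
    by apply: continuous_subspaceT; exact: cst_continuous.
  by move=> z j /H; rewrite finset.inE.
Qed.

Section universal_step.
Variables (L : topologicalType) (l0 : L).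
Hypothesis cpp : connected_pairs_property L.
Variables (k : nat) (F : {set {set 'I_k}}) (s : {set 'I_k}).
Hypothesis F0 : finset.set0 \notin F.
Hypothesis sF : s \in F.
Hypothesis smax : forall t, t \in F -> (#|t| <= #|s|)%N.

(** The space [C] is glued to [X] only where [theta] vanishes, that is, where the weights outside
    [s] are zero. Gluing along all of [X] would impose on [C] weights outside [s], while the new
    face demands that weights on [C] be supported in [s]. *)
Lemma universal_step : universal_for_faces L (F :\ s)%SET -> universal_for_faces L F.
Proof.
move=> [X [mu [cmX eX [cmu mu0 mu1] liftX]]].
have [C [e [[ce [ie _]] [cmC [eC conn]]]]] := cpp cmX eX.
have hC := metrizable_hausdorff cmC.2.
pose theta x : RR := \sum_(j | j \notin s) mu j x.
have ct : continuous theta by move=> x; apply: cont_sum_cond => j; exact: cmu.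
have theta0 x : theta x = 0 <-> forall j, j \notin s -> mu j x = 0.
  split=> [/eqP|H]; last by rewrite /theta big1.
  rewrite psumr_eq0// => /allP H j js; apply/eqP; have := H j.
  by rewrite mem_index_enum js => /(_ isT).
have [T [a [b [cmT ca cb cov [ab univ]]]]] := pushout cmX cmC ce ie ct.
pose Y := [set x | theta x = 0].
have cY : closed Y by exact: preimage_eq0_closed.
have kY : compact Y by apply: subclosed_compact cmX.1 _.
have kX := cmX.1.
pose mv x : 'rV[RR]_k := \row_j mu j x.
have cmv : continuous mv.
  apply: continuous_row => j; rewrite [X in continuous X](_ : _ = mu j)//.
  by apply/funext => x; rewrite mxE.
have exh c : exists v : 'rV[RR]_k, forall x, e x = c -> v = mv x.
  have [[x xc]|nx] := pselect (exists x, e x = c).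
    by exists (mv x) => x' x'c; congr mv; apply: ie; rewrite xc.
  by exists 0 => x xc; exfalso; apply: nx; exists x.
have [h hP] := choice exh.
have hE x : h (e x) = mv x by exact: hP.
have ceY : {within Y, continuous e} by exact: continuous_subspaceT.
have cD : closed (e @` Y) by apply: compact_closed => //; exact: continuous_compact.
have ch : {within e @` Y, continuous h}.
  apply: compact_quotient => //.
  by apply: (@within_eq _ _ _ mv); [move=> x _; rewrite /= hE|exact: continuous_subspaceT].
have [B [_ bB]] : bounded_set (mv @` setT).
  by apply: compact_bounded; apply: continuous_compact => //; exact: continuous_subspaceT.
have [m [cm mh]] : exists g : C -> 'rV[RR]_k, continuous g /\ forall c, (e @` Y) c -> g c = h c.
  apply: (tietze_row (B := `|B| + 1) (metrizable_normal cmC.2)) => //.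
  move=> _ [x _ <-]; rewrite hE; apply: bB; last by exists x.
  by rewrite (le_lt_trans (ler_norm _))// ltrDl.
have me x j : theta x = 0 -> m (e x) ord0 j = mu j x.
  by move=> x0; rewrite mh; [rewrite hE mxE|exists x].
pose S c : RR := \sum_(i in s) `|m c ord0 i|.
have cmj j : continuous (fun c => m c ord0 j).
  apply: (continuous_comp_fun (g := fun v : 'rV[RR]_k => v ord0 j)) => //.
  exact: coord_continuous.
have cS : continuous S by move=> c; apply: cont_sum_cond => j; apply: cont_abs; exact: cmj.
(* On the glued part [m] is given by [mu], whose weights already add up to at least [1], so the
   correction is zero there; elsewhere it keeps the sum at least [1], being counted at least once
   because [s] is nonempty. *)
pose nu j c : RR := if j \in s then `|m c ord0 j| + Order.max 0 (1 - S c) else 0.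
have cnu j : continuous (nu j).
  move=> c; rewrite /nu; case: (j \in s); last exact: cont_cst.
  apply: (cont_add (f := fun c => `|m c ord0 j|) (g := fun c => Order.max 0 (1 - S c))).
    by apply: cont_abs; exact: cmj.
  apply: (cont_max (f := fun=> 0) (g := fun c => 1 - S c)); first exact: cont_cst.
  by apply: (cont_sub (f := fun=> 1)); [exact: cont_cst|exact: cS].
have nu0 j c : 0 <= nu j c.
  by rewrite /nu; case: ifP => // _; rewrite addr_ge0// le_max lexx.
have nu1 c : 1 <= \sum_j nu j c.
  rewrite /nu -big_mkcond /= big_split /= -/(S c) sumr_const.
  have s0 : (0 < #|s|)%N.
    by rewrite card_gt0; apply/eqP => s0; move: F0; rewrite -s0 sF.
  have : Order.max 0 (1 - S c) <= Order.max 0 (1 - S c) *+ #|s|.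
    by case: #|s| s0 => // n0 _; rewrite mulrS lerDl mulrn_wge0// le_max lexx.
  have : 1 - S c <= Order.max 0 (1 - S c) by rewrite le_max lexx orbT.
  lra.
have numu j x : theta x = 0 -> nu j (e x) = mu j x.
  move=> x0; rewrite /nu; case: ifPn => js; last by rewrite ((theta0 x).1 x0).
  have SE : S (e x) = \sum_i mu i x.
    rewrite (bigID (fun i => i \in s)) /= [X in _ + X]big1 ?addr0.
      by apply: eq_bigr => i _; rewrite me// ger0_norm.
    by move=> i; exact: (theta0 x).1.
  by rewrite me// ger0_norm// max_l ?addr0// SE subr_le0.
have exmu j : exists g : T -> RR, [/\ continuous g, forall c, g (a c) = nu j c &
    forall x, g (b x) = mu j x].
  by apply: univ => // x /(numu j).
have [mu' mu'P] := choice exmu.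
have mu'a j c : mu' j (a c) = nu j c by case: (mu'P j).
have mu'b j x : mu' j (b x) = mu j x by case: (mu'P j).
exists T, mu'; split=> //.
- exact: (pushout_edim l0 ce ct ca cb cov ab univ).
- split=> [j|j t|t]; first by case: (mu'P j).
    by case: (cov t) => -[y ->]; rewrite ?mu'a ?mu'b.
  by case: (cov t) => -[y ->]; under eq_bigr do rewrite ?mu'a ?mu'b.
move=> Z pZ eZ A la cA cla laF.
(* [A0] consists of the points whose support misses a vertex of [s], [B0] of those supported in [s].
   By maximality a support containing [s] equals [s], so the two sets cover [A]. Over [A0] the lift
   goes to [X]; on the overlap it lands where [theta] vanishes, and from there it is extended into
   [C]. *)
pose A0 := A `&` [set z | \prod_(j in s) la j z = 0].
pose B0 := A `&` [set z | \sum_(j | j \notin s) `|la j z| = 0].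
have cA0 : closed A0.
  by apply: closedI => //; apply: preimage_eq0_closed => z; apply: cont_prod => j; exact: cla.
have cB0 : closed B0.
  apply: closedI => //; apply: preimage_eq0_closed => z; apply: cont_sum_cond => j.
  by apply: cont_abs; exact: cla.
have A0P z : A z -> ~ A0 z -> [set j | la j z != 0]%SET = s.
  move=> Az nA0; apply/esym/eqP; rewrite eqEcard smax ?laF// andbT.
  apply/fintype.subsetP => j js; rewrite finset.inE; apply/eqP => l0'; apply: nA0; split=> //.
  by rewrite /= (bigD1 j)//= l0' mul0r.
have AB z : A z -> A0 z \/ B0 z.
  move=> Az; have [|nA0] := pselect (A0 z); [by left|right; split=> //=].
  rewrite big1// => j; rewrite -(A0P z Az nA0) finset.inE negbK => /eqP ->.
  by rewrite normr0.
have la0 z : A0 z -> [set j | la j z != 0]%SET \in (F :\ s)%SET.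
  move=> [Az /eqP/prodf_eq0 [j js /eqP lj]]; rewrite finset.in_setD1 laF// andbT.
  by apply/eqP => E; move: js; rewrite -E finset.inE lj eqxx.
have [q0 [cq0 q0P]] := liftX Z pZ eZ A0 la cA0 cla la0.
have q0Y z : A0 z -> B0 z -> theta (q0 z) = 0.
  move=> Az [_ /= /eqP]; rewrite psumr_eq0 // => /allP H.
  apply/theta0 => j js; apply: q0P => //; apply/eqP.
  by have := H j; rewrite mem_index_enum js normr_eq0 => /(_ isT).
have [_ [_ extC]] := conn Z pZ eZ.
have [q1 [cq1 [_ q1P]]] : exists g : Z -> C, continuous g /\ range g `<=` setT /\
    forall z, (A0 `&` B0) z -> g z = e (q0 z).
  apply: (extC (A0 `&` B0) (e \o q0)); first exact: closedI.
    apply: (within_comp (B := setT)) => //; last exact: continuous_subspaceT.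
    by apply: continuous_subspaceW cq0 => z [].
  by move=> _ [z _ <-]; exists (q0 z).
exists (fun z => if `[< A0 z >] then b (q0 z) else a (q1 z)); split.
  have -> : A = A0 `|` B0.
    by apply/seteqP; split=> z; [exact: AB|case=> -[]].
  apply: (paste_within (f := b \o q0) (g := a \o q1)) => //.
  - by apply: (within_comp (B := setT)) => //; exact: continuous_subspaceT.
  - by apply: continuous_subspaceT; exact: continuous_comp_fun.
  - by move=> z Az Bz /=; rewrite q1P// -ab//; exact: q0Y.
move=> z j Az lz; case: asboolP => [A0z|nA0].
  by rewrite mu'b; exact: q0P.
by rewrite mu'a /nu -(A0P z Az nA0) finset.inE lz eqxx.
Qed.

End universal_step.

Lemma universal_simplex (L : topologicalType) (l0 : L) (k : nat) (j0 : 'I_k) :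
  connected_pairs_property L ->
  universal_for_faces L (~: [set finset.set0] : {set {set 'I_k}})%SET.
Proof.
move=> cpp.
suff H n (F : {set {set 'I_k}}) : #|F| = n -> finset.set0 \notin F ->
    (forall s t : {set 'I_k}, s \in F -> t \subset s -> t != finset.set0 -> t \in F) ->
    universal_for_faces L F.
  by apply: (H _ _ erefl); [|move=> s t _ _ t0]; rewrite !finset.inE ?negbK.
elim: n => [|n IH] in F *.
  by move=> /cards0_eq -> _ _; exact: universal_for_no_face.
move=> Fn F0 Fd.
have [s0 s0F] : exists s, s \in F by apply/card_gt0P; rewrite Fn.
have [s sF smax] : exists2 s, s \in F & forall t, t \in F -> (#|t| <= #|s|)%N.
  by case: (@arg_maxnP _ s0 (fun s => s \in F) (fun s => #|s|) s0F) => s sF smax; exists s.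
apply: (universal_step l0 cpp F0 sF smax); apply: IH.
- by have := cardsD1 s F; rewrite sF Fn => -[].
- by rewrite finset.in_setD1 negb_and F0 orbT.
- move=> t t'; rewrite !finset.in_setD1 => /andP[ts tF] t't t'0.
  rewrite (Fd _ _ tF t't t'0) andbT; apply: contra ts => /eqP st'.
  by rewrite eq_sym eqEcard -{1}st' t't smax.
Qed.

Lemma segment_sub (M : nat) (u v : 'rV[RR]_M) (s : RR) :
  (1 - s) *: u + s *: v - u = s *: (v - u).
Proof. by apply/rowP => i; rewrite !mxE; ring. Qed.

Lemma convex_comb_dist (M k : nat) (x : 'I_k -> 'rV[RR]_M) (c : 'I_k -> RR)
    (p : 'rV[RR]_M) (d : RR) :
  (forall j, 0 <= c j) -> 0 < \sum_j c j ->
  (forall j, c j != 0 -> `|p - x j| <= d) ->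
  `|p - (\sum_j c j)^-1 *: \sum_j c j *: x j| <= d.
Proof.
move=> c0 s0 cd; set s := \sum_j c j.
have -> : p - s^-1 *: \sum_j c j *: x j = s^-1 *: \sum_j c j *: (p - x j).
  under [in RHS]eq_bigr do rewrite scalerBr.
  by rewrite sumrB -scaler_suml -/s scalerBr scalerA mulVf ?scale1r// gt_eqF.
have sp : 0 < s by [].
rewrite normrZ (gtr0_norm (x := s^-1)) ?invr_gt0// [leLHS]mulrC ler_pdivrMr//.
apply: (le_trans (ler_norm_sum _ _ _)).
rewrite mulr_sumr; apply: ler_sum => j _; rewrite normrZ (ger0_norm (c0 j)) mulrC.
have [->|cj] := eqVneq (c j) 0; first by rewrite !mulr0.
by rewrite ler_wpM2r// cd.
Qed.

(* The vertex [ord0] of the simplex of [universal_simplex] absorbs the points whose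
   image is far from [K0]. *)
Lemma universal_approximation (L : topologicalType) (l0 : L) (M : nat)
    (K0 : set 'rV[RR]_M) (d : RR) :
  connected_pairs_property L -> compact K0 -> 0 < d ->
  exists (K : topologicalType) (h : K -> 'rV[RR]_M),
    [/\ metrizable_compactum K, edim_le K L, continuous h &
      forall Z : topologicalType, polish Z -> edim_le Z L ->
      forall g : Z -> 'rV[RR]_M, continuous g ->
      exists q : Z -> K, continuous q /\ forall z, K0 (g z) -> `|g z - h (q z)| <= d].
Proof.
move=> cpp kK0 d0; have d20 : 0 < d / 2 by rewrite divr_gt0.
have [k [x [_ xK]]] := compact_tuple_net kK0 d20.
have [K [mu [cmK eK [cmu mu0 mu1] lift]]] := universal_simplex l0 (ord0 : 'I_k.+1) cpp.
pose y (j : 'I_k.+1) := if unlift ord0 j is Some i then x i else 0.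
have s0 t : 0 < \sum_j mu j t by apply: lt_le_trans (mu1 t).
pose h t := (\sum_j mu j t)^-1 *: \sum_j mu j t *: y j.
exists K, h; split=> //.
  move=> t; apply: (cont_vscale (f := fun t => (\sum_j mu j t)^-1)
    (v := fun t => \sum_j mu j t *: y j)).
    by apply: cont_inv; [rewrite gt_eqF|apply: cont_sum => j; exact: cmu].
  apply: (@cont_vsum _ 'rV[RR]_M) => j.
  by apply: (cont_vscale (f := mu j) (v := fun=> y j)); [exact: cmu|exact: cont_cst].
move=> Z pZ eZ g cg.
(* [la0 i] vanishes at distance [d] or more from [x i], which keeps far net points out of the convex
   combination. The net has mesh [d / 2], so over [K0] some [la0 i] exceeds [d / 2] and switches
   [la1] off; if all [la0 i] vanish, [la1] is positive, so the support is never empty. *)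
pose la0 i z : RR := Order.max 0 (d - `|g z - x i|).
pose la1 z : RR := Order.max 0 (d / 2 - \sum_i la0 i z).
pose la (j : 'I_k.+1) z := if unlift ord0 j is Some i then la0 i z else la1 z.
have cla0 i : continuous (la0 i).
  move=> z; apply: (cont_max (f := fun=> 0) (g := fun z => d - `|g z - x i|)).
    exact: cont_cst.
  apply: (cont_sub (f := fun=> d)); first exact: cont_cst.
  by apply: cont_vnorm; apply: (cont_vsub (v := fun=> x i)); [exact: cg|exact: cont_cst].
have cla1 : continuous la1.
  move=> z; apply: (cont_max (f := fun=> 0) (g := fun z => d / 2 - \sum_i la0 i z)).
    exact: cont_cst.
  apply: (cont_sub (f := fun=> d / 2)); first exact: cont_cst.
  by apply: cont_sum => i; exact: cla0.
have la0_ge0 i z : 0 <= la0 i z by rewrite le_max lexx.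
have cla j : continuous (la j).
  by rewrite /la; case: (unlift ord0 j) => [i|]; [exact: cla0|exact: cla1].
have laP z : setT z ->
    [set j | la j z != 0]%SET \in (~: [set finset.set0] : {set {set 'I_k.+1}})%SET.
  move=> _; rewrite !finset.inE; apply/eqP => E.
  have all0 j : la j z = 0.
    have : j \notin [set j | la j z != 0]%SET by rewrite E finset.inE.
    by rewrite finset.inE negbK => /eqP.
  have := all0 ord0; rewrite /la unlift_none /la1 big1 ?subr0.
    by rewrite max_r ?ltW// => dd; move: d20; rewrite dd ltxx.
  by move=> i _; have := all0 (fintype.lift ord0 i); rewrite /la liftK.
have [q [cq qP]] := lift Z pZ eZ setT la closedT cla laP.
exists q; split; first exact/continuous_subspace_setT.
move=> z Kz; apply: convex_comb_dist => // j muj.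
have : la j z != 0 by apply: contra muj => /eqP lj; apply/eqP; exact: qP.
rewrite /la /y; case: (unlift ord0 j) => [i|].
  rewrite /la0; case: (leP 0 (d - `|g z - x i|)) => [dx _|_]; last by rewrite eqxx.
  by rewrite -subr_ge0.
have [i gx] := xK _ Kz.
rewrite /la1 max_l ?eqxx// subr_le0.
apply: (@le_trans _ _ (la0 i z)); last first.
  by rewrite (bigD1 i)//= lerDl; apply: sumr_ge0 => i' _.
by rewrite /la0 le_max; apply/orP; right; lra.
Qed.

(** * From connected pairs to quasi-finiteness *)

Section cpp_to_qf.
Variables (L : topologicalType) (W : cell_data L).
Hypothesis cwW : is_CW W.
Hypothesis lfW : CW_locally_finite W.

Lemma compact_sub_finite_subcomplex (K : set L) : compact K ->
  exists2 J, @finite_subcomplex L W J & K `<=` cells_union J.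
Proof.
move=> kK; have [J fJ KJ] := compact_sub_subcomplex cwW lfW kK.
by exists J => // x /KJ; exact: interior_subset.
Qed.

Lemma connected_pairs_quasi_finite : connected_pairs_property L -> quasi_finite W.
Proof.
move=> cpp P fP sP.
(* If [L] is empty, then so is every [Z] with e-dim at most [[L]], and [P] itself serves. *)
have [[l0 _]|nL] := pselect (exists l : L, True); last first.
  exists P; split=> //; split=> //; split=> // Z pZ [[[l _]|nZ] eZ].
    by exfalso; apply: nL; exists l.
  split=> //; split; first by right.
  move=> A f cA cf fA; exists f; split=> [x|]; first by exfalso; apply: nZ; exists x.
  by split=> // l _; exfalso; apply: nL; exists l.
have hL : hausdorff_space L by case: cwW.
have [Q fQ PQ] := compact_sub_subcomplex cwW lfW (cells_union_compact cwW fP sP).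
have kQ := cells_union_compact cwW fQ.1 fQ.2.
have [E] := finite_subcomplex_enr cwW l0 fQ.
pose K0 := enr_in E @` cells_union Q.
have kK0 : compact K0 by apply: continuous_compact => //; exact: enr_in_continuous.
have [|d d0 dO] := compact_thickening kK0 (enr_open E).
  by move=> _ [x Qx <-]; exact: enr_in_dom.
have [K [h [cmK eK ch app]]] := universal_approximation l0 cpp kK0 d0.
pose T := [set w | exists2 p, K0 p & `|w - p| <= d].
have cT : closed T by exact: thickening_closed.
have TO w : T w -> enr_dom E w by move=> [p Kp wp]; exact: dO wp.
(* Uses e-dim of [K]. Since [K] and [G] do not involve [Z], the subcomplex [R] around the image of
   [G] is fixed before any [Z] appears. *)
have [G [cG GP]] : exists G : K -> L, continuous G /\
    forall t, (h @^-1` T) t -> G t = enr_ret E (h t).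
  apply: (eK.2 (h @^-1` T) (enr_ret E \o h)); first by apply: preimage_closed => // t _; exact: ch.
  apply: (within_comp (B := enr_dom E)).
  - exact: continuous_subspaceT.
  - by move=> t /TO.
  - by apply: continuous_in_subspaceT => w /set_mem; exact: enr_ret_continuous.
have [R fR GR] : exists2 R, @finite_subcomplex L W R & range G `<=` cells_union R.
  apply: compact_sub_finite_subcomplex; apply: continuous_compact; last exact: cmK.1.
  exact: continuous_subspaceT.
(* [R0] makes the target nonempty, as a connected pair requires for nonempty [Z] even when [A] is
   empty. *)
have [R0 fR0 lR0] : exists2 R, @finite_subcomplex L W R & [set l0] `<=` cells_union R.
  by apply: compact_sub_finite_subcomplex; exact: compact_set1.
have QRU : cells_union (Q `|` (R `|` R0)) =
    cells_union Q `|` (cells_union R `|` cells_union R0).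
  by rewrite /cells_union !bigcup_setU.
have [fQR sQR] := finite_subcomplexU fQ (finite_subcomplexU fR fR0).
have PQ' : P `<=` Q.
  move=> i Pi; have [y0 oy0] : exists y : 'rV[RR]_(cw_dim i), open_disk (cw_dim i) y.
    exists 0; rewrite open_diskE /eucl (_ : sqnorm 0 = 0) ?sqrtr0//.
    by rewrite /sqnorm big1// => j _; rewrite mxE expr0n.
  have oi : ocell i (cw_char i y0) by exists y0.
  apply: (cells_union_mem cwW _ oi); apply: interior_subset; apply: PQ.
  by exists i.
exists (Q `|` (R `|` R0)); split=> //; split=> //; split; first by move=> i /PQ'; left.
move=> Z pZ eZ; have nZ := polish_normal pZ.
split; first by move=> x [i Pi oi]; exists i => //; left; exact: PQ'.
split; first by left; exists l0; rewrite QRU; right; right; exact: lR0.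
move=> A f cA cf fAP.
(* [F] need not stay in a finite subcomplex. Its values are kept on [A]; outside [N] it is replaced
   by [G \o q], which stays in [R], and the switch takes place inside [N], where [F] lies in [Q]. *)
have [F [cF Ff]] := eZ.2 A f cA cf.
pose N := F @^-1` cells_union Q.
have cN : closed N by apply: preimage_closed; [move=> z _; exact: cF|exact: fQ.2].
pose U := F @^-1` (cells_union Q)°.
have oU : open U by apply: open_comp; [move=> z _; exact: cF|exact: open_interior].
have AU : A `<=` U by move=> z Az; rewrite /U /= Ff//; apply/PQ/fAP; exists z.
have UN : U `<=` N by move=> z; exact: interior_subset.
have [B [_ bB]] := compact_bounded kK0.
have [g [cg gP]] : exists g : Z -> 'rV[RR]_(enr_dim E), continuous g /\
    forall z, N z -> g z = enr_in E (F z).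
  apply: (tietze_row (B := `|B| + 1) nZ cN).
    apply: (within_comp (B := cells_union Q)) => //; last exact: enr_in_continuous.
    exact: continuous_subspaceT.
  move=> z Nz; apply: bB; last by exists (F z).
  by rewrite (le_lt_trans (ler_norm _))// ltrDl.
have [q [cq qP]] := app Z pZ eZ g cg.
have K0g z : N z -> K0 (g z) by move=> Nz; rewrite gP//; exists (F z).
have [||||Phi [cPhi PhiA PhinN PhiN]] := @patch Z L _ (enr_dom E) (enr_ret E) g (h \o q)
    (G \o q) A U N nZ cA oU cN AU UN (@enr_ret_continuous _ _ E) cg.
- exact: continuous_comp_fun.
- exact: continuous_comp_fun.
- move=> z s Nz /andP[s0 s1]; apply: (dO (g z)); first exact: K0g.
  have -> : (1 - s) *: g z + s *: h (q z) - g z = s *: (h (q z) - g z).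
    exact: segment_sub.
  rewrite normrZ distrC ger0_norm//.
  by apply: le_trans (qP z (K0g z Nz)); rewrite ler_piMl.
- move=> z Nz /=; rewrite GP//=; exists (g z); first exact: K0g.
  by rewrite distrC; apply: qP; exact: K0g.
exists Phi; split=> //; split.
  move=> _ [z _ <-]; rewrite QRU; have [Nz|nNz] := pselect (N z).
    by left; have [w Ow ->] := PhiN z Nz; exact: enr_ret_sub.
  by right; left; rewrite PhinN//; apply: GR; exists (q z).
move=> z Az; rewrite PhiA// gP; last exact/UN/AU.
rewrite enr_inK; [exact: Ff|exact/UN/AU].
Qed.

End cpp_to_qf.

Lemma open_thickening (M : nat) (K : set 'rV[RR]_M) (d : RR) :
  open [set w | exists2 p, K p & `|w - p| < d].
Proof.
rewrite openE => w [p Kp wp].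
have c : {for w, continuous (fun z : 'rV[RR]_M => `|z - p|)}.
  apply: cont_vnorm.
  by apply: (cont_vsub (u := idfun) (v := fun=> p)); [exact: cvg_id|exact: cont_cst].
have := near_lt (f := fun z : 'rV[RR]_M => `|z - p|) c wp.
by apply: filterS => z zp; exists p.
Qed.

(* [((b, k), (p, q))] stands for the affine function [p * x_(b, k) + q]. *)
Definition atom : Type := ((nat * nat) * (rat * rat))%type.
Definition lat_row : Type := (atom * seq atom)%type.
Definition lat_expr : Type := (lat_row * seq lat_row)%type.

Definition atom_eval (a : atom) (w : nat -> nat -> RR) : RR :=
  ratr a.2.1 * w a.1.1 a.1.2 + ratr a.2.2.
Definition row_eval (r : lat_row) w : RR :=
  @foldr atom RR (fun a m => Order.min (atom_eval a w) m) (atom_eval r.1 w) r.2.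
Definition lat_eval (e : lat_expr) w : RR :=
  @foldr lat_row RR (fun r m => Order.max (row_eval r w) m) (row_eval e.1 w) e.2.

(** * Rational lattice expressions and their density *)

Section lat_continuous.
Variables (T : topologicalType) (w : T -> nat -> nat -> RR) (x : T).
Hypothesis cw : forall b k, {for x, continuous (fun t => w t b k)}.

Lemma atom_continuous a : {for x, continuous (fun t => atom_eval a (w t))}.
Proof.
apply: (cont_add (f := fun t => ratr a.2.1 * w t a.1.1 a.1.2) (g := fun=> ratr a.2.2)).
  by apply: (cont_mul (f := fun=> ratr a.2.1)); [exact: cont_cst|exact: cw].
exact: cont_cst.
Qed.

Lemma row_continuous r : {for x, continuous (fun t => row_eval r (w t))}.
Proof.
case: r => a s; rewrite /row_eval /=; elim: s => [|b s IH] /=; first exact: atom_continuous.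
apply: (cont_min (f := fun t => atom_eval b (w t))
  (g := fun t => @foldr atom RR 
    (fun a m => Order.min (atom_eval a (w t)) m) (atom_eval a (w t)) s)).
  exact: atom_continuous.
exact: IH.
Qed.

Lemma lat_continuous e : {for x, continuous (fun t => lat_eval e (w t))}.
Proof.
case: e => a s; rewrite /lat_eval /=; elim: s => [|b s IH] /=; first exact: row_continuous.
apply: (cont_max (f := fun t => row_eval b (w t))
  (g := fun t => @foldr lat_row RR 
    (fun r m => Order.max (row_eval r (w t)) m) (row_eval a (w t)) s)).
  exact: row_continuous.
exact: IH.
Qed.

End lat_continuous.

Lemma row_eval_lt r w (c : RR) :
  row_eval r w < c <-> exists2 a, a \in r.1 :: r.2 & atom_eval a w < c.
Proof.
case: r => a s; rewrite /row_eval /=; elim: s => [|b s IH] /=.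
  split=> [ac|[b]]; first by exists a; rewrite ?inE.
  by rewrite inE => /eqP ->.
rewrite gt_min; split.
  case/orP => [bc|/IH [d ds dc]]; first by exists b; rewrite // !inE eqxx orbT.
  by exists d => //; move: ds; rewrite !inE => /orP[->|->]; rewrite ?orbT.
move=> [d]; rewrite !inE => ds dc; apply/orP.
have [/eqP db|db] := boolP (d == b); first by left; rewrite -db.
right; apply/IH; exists d => //; rewrite inE.
by move: ds; rewrite (negbTE db).
Qed.

Lemma lat_eval_gt e w (c : RR) :
  c < lat_eval e w <-> exists2 r, r \in e.1 :: e.2 & c < row_eval r w.
Proof.
case: e => a s; rewrite /lat_eval /=; elim: s => [|b s IH] /=.
  split=> [ac|[b]]; first by exists a; rewrite ?inE.
  by rewrite inE => /eqP ->.
rewrite lt_max; split.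
  case/orP => [bc|/IH [d ds dc]]; first by exists b; rewrite // !inE eqxx orbT.
  by exists d => //; move: ds; rewrite !inE => /orP[->|->]; rewrite ?orbT.
move=> [d]; rewrite !inE => ds dc; apply/orP.
have [/eqP db|db] := boolP (d == b); first by left; rewrite -db.
right; apply/IH; exists d => //; rewrite inE.
by move: ds; rewrite (negbTE db).
Qed.

Lemma row_eval_gt r w (c : RR) :
  (forall a, a \in r.1 :: r.2 -> c < atom_eval a w) -> c < row_eval r w.
Proof.
case: r => a s; rewrite /row_eval /=; elim: s => [|b s IH] H /=.
  by apply: H; rewrite inE.
rewrite lt_min H/=; last by rewrite !inE eqxx orbT.
by apply: IH => d ds; apply: H; move: ds; rewrite !inE => /orP[->|->]; rewrite ?orbT.
Qed.

Lemma lat_eval_lt e w (c : RR) :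
  (forall r, r \in e.1 :: e.2 -> row_eval r w < c) -> lat_eval e w < c.
Proof.
case: e => a s; rewrite /lat_eval /=; elim: s => [|b s IH] H /=.
  by apply: H; rewrite inE.
rewrite gt_max H/=; last by rewrite !inE eqxx orbT.
by apply: IH => d ds; apply: H; move: ds; rewrite !inE => /orP[->|->]; rewrite ?orbT.
Qed.

Lemma atom_eval_support a : exists N : nat, forall w w' : nat -> nat -> RR,
  (forall b k, (b <= N)%N -> w b k = w' b k) -> atom_eval a w = atom_eval a w'.
Proof. by exists a.1.1 => w w' ww; rewrite /atom_eval ww. Qed.

Lemma foldr_support (T : Type) (ev : T -> (nat -> nat -> RR) -> RR) (op : RR -> RR -> RR)
    (a : T) (s : seq T) :
  (forall a, exists N : nat, forall w w' : nat -> nat -> RR,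
    (forall b k, (b <= N)%N -> w b k = w' b k) -> ev a w = ev a w') ->
  exists N : nat, forall w w' : nat -> nat -> RR,
    (forall b k, (b <= N)%N -> w b k = w' b k) ->
    foldr (fun a => op (ev a w)) (ev a w) s = foldr (fun a => op (ev a w')) (ev a w') s.
Proof.
move=> evN; elim: s => [|c s [N IH]] /=; first exact: evN.
have [N' cN'] := evN c; exists (maxn N N') => w w' ww.
congr op; [apply: cN'|apply: IH] => b k bN; apply: ww; rewrite leq_max bN ?orbT//.
Qed.

(** An expression reads finitely many blocks of coordinates, so from some stage on truncation does
    not change its value. *)
Lemma lat_eval_support e : exists N : nat, forall w w' : nat -> nat -> RR,
  (forall b k, (b <= N)%N -> w b k = w' b k) -> lat_eval e w = lat_eval e w'.
Proof.
apply: (@foldr_support _ row_eval) => r.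
exact: (@foldr_support _ atom_eval _ _ _ atom_eval_support).
Qed.

Lemma rat_approx (x e : RR) : 0 < e -> exists q : rat, `|ratr q - x| < e.
Proof.
move=> e0; have [|q] := @rat_in_itvoo RR (x - e) (x + e); first by lra.
by rewrite in_itv /= => /andP[q1 q2]; exists q; rewrite ltr_norml; lra.
Qed.

(* The Kakutani-Stone argument. *)
Lemma lattice_dense (T : topologicalType) (w : T -> nat -> nat -> RR) (F : T -> RR)
    (e : RR) :
  compact [set: T] -> (forall b k, continuous (fun t => w t b k)) ->
  (forall x y, (forall b k, w x b k = w y b k) -> x = y) ->
  continuous F -> 0 < e ->
  exists f : lat_expr, forall t, `|lat_eval f (w t) - F t| < e.
Proof.
move=> cT cw sep cF e0.
pose z0 : atom := ((0%N, 0%N), (0, 0)).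
have [[t0 _]|nT] := pselect (exists t : T, True); last first.
  by exists ((z0, [::]), [::]) => t; exfalso; apply: nT; exists t.
have two x y : exists a, `|atom_eval a (w x) - F x| < e /\ `|atom_eval a (w y) - F y| < e.
  have [Fxy|Fxy] := eqVneq (F x) (F y).
    have [q qF] := rat_approx (F x) e0.
    by exists ((0%N, 0%N), (0, q)); rewrite /atom_eval /= rmorph0 !mul0r !add0r -Fxy.
  have [b [k wbk]] : exists b k, w x b k != w y b k.
    apply: contrapT => H; move/eqP : Fxy; apply; congr F; apply: sep => b k.
    by apply/eqP/negPn/negP => wbk; apply: H; exists b, k.
  set u := w x b k in wbk; set v := w y b k in wbk.
  have uv : u - v != 0 by rewrite subr_eq0.
  pose al := (F x - F y) / (u - v); pose be := F x - al * u.
  have bu : al * u + be = F x by rewrite /be; ring.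
  have bv : al * v + be = F y.
    have : al * (u - v) = F x - F y by rewrite /al divfK.
    by rewrite /be mulrBr; lra.
  (* [m] bounds both values of the separating coordinate, so errors of [e / (2 * m)] in the slope
     and [e / 2] in the constant term together stay below [e]. *)
  pose m := `|u| + `|v| + 1.
  have m0 : 0 < m by rewrite /m ltr_wpDl// addr_ge0.
  have [p pal] := rat_approx al (divr_gt0 e0 (mulr_gt0 (ltr0n _ 2) m0)).
  have [q qbe] := rat_approx be (divr_gt0 e0 (ltr0n _ 2)).
  have key z : `|z| <= m -> `|ratr p * z + ratr q - (al * z + be)| < e.
    move=> zm; rewrite (_ : _ - _ = (ratr p - al) * z + (ratr q - be)); last by ring.
    apply: (le_lt_trans (ler_normD _ _)); rewrite normrM.
    have : `|ratr p - al| * `|z| <= e / (2 * m) * m by apply: ler_pM => //; exact: ltW.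
    rewrite (_ : e / (2 * m) * m = e / 2); last by field; lra.
    by move: qbe; lra.
  exists ((b, k), (p, q)); rewrite /atom_eval /= -/u -/v -{1}bu -bv; split; apply: key.
    by rewrite /m -addrA lerDl addr_ge0.
  by rewrite /m addrAC lerDr addr_ge0.
have [at_ atP] := choice (fun xy => two xy.1 xy.2).
(* For fixed [x], the minimum of the two-point interpolants over finitely many [y] is below [F + e]
   everywhere and still above [F - e] at [x]. The maximum of finitely many such rows then satisfies
   both bounds everywhere. *)
have rows x : exists r, F x - e < row_eval r (w x) /\ forall t, row_eval r (w t) < F t + e.
  have [|s _ sN] := @compact_finite_net _ _
      (fun y => [set t | atom_eval (at_ (x, y)) (w t) < F t + e]) cT.
    move=> y _; have [_] := atP (x, y); rewrite ltr_norml /= => /andP[_ ay].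
    have c : {for y, continuous (fun t => F t - atom_eval (at_ (x, y)) (w t))}.
      by apply: cont_sub; [exact: cF|apply: atom_continuous => b k; exact: cw].
    have := near_gt (f := fun t => F t - atom_eval (at_ (x, y)) (w t)) (c := - e) c.
    move=> /(_ ltac:(lra)); apply: filterS => t /=; lra.
  exists (at_ (x, x), [seq at_ (x, y) | y <- s]); split.
    apply: row_eval_gt => a /=; rewrite inE => /orP[/eqP ->|/mapP [y _ ->]].
      by have [+ _] := atP (x, x); rewrite ltr_norml /= => /andP[+ _]; lra.
    by have [+ _] := atP (x, y); rewrite ltr_norml /= => /andP[+ _]; lra.
  move=> t; apply/row_eval_lt; have [y ys yt] := sN t I.
  by exists (at_ (x, y)) => //; rewrite inE map_f ?orbT.
have [ro roP] := choice rows.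
have [|s _ sN] := @compact_finite_net _ _ (fun x => [set t | F t - e < row_eval (ro x) (w t)]) cT.
  move=> x _; have [rx _] := roP x.
  have c : {for x, continuous (fun t => row_eval (ro x) (w t) - F t)}.
    by apply: cont_sub; [apply: row_continuous => b k; exact: cw|exact: cF].
  have := near_gt (f := fun t => row_eval (ro x) (w t) - F t) (c := - e) c.
  move=> /(_ ltac:(lra)); apply: filterS => t /=; lra.
exists (ro t0, [seq ro x | x <- s]) => t.
rewrite ltr_norml; apply/andP; split.
  rewrite ltrBrDr addrC; apply/lat_eval_gt; have [x xs xt] := sN t I.
  by exists (ro x) => //; rewrite inE map_f ?orbT.
rewrite ltrBlDr addrC; apply: lat_eval_lt => r /=; rewrite inE.
by case/orP => [/eqP ->|/mapP [x _ ->]]; exact: (roP _).2.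
Qed.

Lemma dependent_choice (T : Type) (t0 : T) (R : nat -> (nat -> T) -> T -> Prop) :
  (forall n p q x, (forall m, (m < n)%N -> p m = q m) -> R n p x -> R n q x) ->
  (forall n p, (forall m, (m < n)%N -> R m p (p m)) -> exists x, R n p x) ->
  exists s, forall n, R n s (s n).
Proof.
move=> Rext Rex.
have ex np : exists x, (forall m, (m < np.1)%N -> R m np.2 (np.2 m)) -> R np.1 np.2 x.
  have [H|H] := pselect (forall m, (m < np.1)%N -> R m np.2 (np.2 m)); last by exists t0.
  by have [x] := Rex _ _ H; exists x.
have [f fP] := choice ex.
(* [S n] tabulates the first [n] choices, with [t0] beyond them; [Rext] makes [R n] blind to the
   difference between this table and the final sequence. *)
pose S := fix S n : nat -> T := if n is n'.+1
  then fun m => if m == n' then f (n', S n') else S n' m else fun=> t0.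
pose s n := f (n, S n).
have Ss n m : (m < n)%N -> S n m = s m.
  elim: n => // n IH; rewrite ltnS leq_eqVlt /= => /orP[/eqP ->|mn].
    by rewrite eqxx.
  by rewrite ltn_eqF// IH.
exists s => n; have [k] := ubnP n; elim: k n => // k IH n; rewrite ltnS => nk.
apply: (Rext n (S n)); first by move=> m mn; exact: Ss.
apply: (fP (n, S n)) => /= m mn; rewrite Ss//.
apply: (Rext m s); last by apply: IH; exact: leq_trans nk.
by move=> i im; rewrite Ss//; exact: ltn_trans mn.
Qed.

Lemma tietze01 (X : topologicalType) (A : set X) (f : X -> RR) :
  normal_space X -> closed A -> {within A, continuous f} ->
  (forall x, A x -> 0 <= f x <= 1) ->
  exists g : X -> RR, [/\ continuous g, forall x, 0 <= g x <= 1 & forall x, A x -> g x = f x].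
Proof.
move=> nX cA cf f01.
have [|g [gf cg _]] := continuous_bounded_extension nX cA (@ltr01 RR) cf.
  by move=> x /f01 /andP[f0 f1]; rewrite ger0_norm.
exists (fun x => clamp (g x)); split.
- exact: (continuous_comp_fun cg clamp_continuous).
- by move=> x; rewrite clamp_ge0 clamp_le1.
- move=> x Ax; rewrite -(gf x (mem_set Ax)) /clamp; have /andP[f0 f1] := f01 x Ax.
  by rewrite min_r// max_r.
Qed.

Lemma prod_continuous (I : Type) (Z : topologicalType) (f : Z -> prod_topology (fun _ : I => RR)) :
  (forall i, continuous (fun z => f z i)) -> continuous f.
Proof.
move=> cf z; apply/cvg_sup => i U [_ [[V oV <-] Vz] VU].
apply: filterS VU _; apply: (cf i z V).
by apply: open_nbhs_nbhs.
Qed.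

Section padding.
Variable M : nat.

(* Row vectors as finitely supported sequences. *)
Definition pad (v : 'rV[RR]_M) (k : nat) : RR :=
  if @insub nat (fun i => (i < M)%N) 'I_M k is Some i then v ord0 i else 0.
Definition unpad (f : nat -> RR) : 'rV[RR]_M := \row_i f i.

Lemma padK v : unpad (pad v) = v.
Proof. by apply/rowP => i; rewrite mxE /pad valK. Qed.

Lemma pad_continuous k : continuous (fun v => pad v k).
Proof.
rewrite /pad => v; case: insubP => [i _ _|_]; first exact: coord_continuous.
exact: cont_cst.
Qed.

Lemma unpad_continuous (Z : topologicalType) (f : Z -> nat -> RR) :
  (forall k, continuous (fun z => f z k)) -> continuous (fun z => unpad (f z)).
Proof.
move=> cf; apply: continuous_row => i.
rewrite [X in continuous X](_ : _ = fun z => f z i)//.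
by apply/funext => z; rewrite mxE.
Qed.

End padding.

(** * From quasi-finiteness to connected pairs: the compactum [C] *)

Section construction.
Variables (L : topologicalType) (W : cell_data L) (l0 : L).
Hypothesis cwW : is_CW W.
Hypothesis lfW : CW_locally_finite W.
Variable code : cw_I W -> nat.
Hypothesis code_inj : injective code.
Variable next : set (cw_I W) -> set (cw_I W).
Hypothesis nextP : forall J, finite_subcomplex J ->
  [/\ finite_subcomplex (next J), J `<=` next J &
      L_connected_Polish L (cells_union J) (cells_union (next J))].

(** Lists that do not code a finite subcomplex are read as the empty one, so every list gives a
    legitimate problem. *)
Let dec (s : seq nat) : set (cw_I W) :=
  if `[< finite_subcomplex [set i | code i \in s] >] then [set i | code i \in s] else set0.

Let dec_sub s : finite_subcomplex (dec s).
Proof. by rewrite /dec; case: asboolP => // _; exact: finite_subcomplex0. Qed.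

Let dec_surj J : finite_subcomplex J -> exists s, dec s = J.
Proof.
move=> fJ; have [s sE] := (finite_seqP _).1 (finite_image code fJ.1).
exists s; rewrite /dec; suff -> : [set i | code i \in s] = J by rewrite asboolT.
apply/seteqP; split=> i /=.
  move=> cs; have : [set` s] (code i) by [].
  by rewrite -sE => -[j Jj /code_inj <-].
by move=> Ji; have : (code @` J) (code i) by [exists i]; rewrite sE.
Qed.

Let dec1 s := next (dec s).
Let dec2 s := next (dec1 s).
Let dec1_sub s : finite_subcomplex (dec1 s). Proof. by case: (nextP (dec_sub s)). Qed.
Let dec2_sub s : finite_subcomplex (dec2 s). Proof. by case: (nextP (dec1_sub s)). Qed.

Let ex_enr (J : set (cw_I W)) : finite_subcomplex J -> exists e : enr (cells_union J), True.
Proof. by move=> /(finite_subcomplex_enr cwW l0) [e]; exists e. Qed.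

Let E0 s : enr (cells_union (dec s)) := projT1 (cid (ex_enr (dec_sub s))).
Let E2 s : enr (cells_union (dec2 s)) := projT1 (cid (ex_enr (dec2_sub s))).

Let K0 s := enr_in (E0 s) @` cells_union (dec s).
Arguments K0 : clear implicits.
Let kK0 s : compact (K0 s).
Proof.
apply: continuous_compact; first exact: enr_in_continuous.
by have [f c] := dec_sub s; exact: cells_union_compact.
Qed.

Let ex_rad s : exists d : RR, 0 < d /\ forall p w, K0 s p -> `|w - p| <= d -> enr_dom (E0 s) w.
Proof.
have [|d d0 dP] := compact_thickening (@kK0 s) (enr_open (E0 s)).
  by move=> _ [x xs <-]; exact: enr_in_dom.
by exists d.
Qed.
Let rad s := projT1 (cid (ex_rad s)).
Let rad0 s : 0 < rad s. Proof. by case: (projT2 (cid (ex_rad s))). Qed.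
Let radP s p w : K0 s p -> `|w - p| <= rad s -> enr_dom (E0 s) w.
Proof. by case: (projT2 (cid (ex_rad s))) => _; apply. Qed.

(* Solutions are prescribed on the closed thickening, but [Cset] below tests them on
   the open one only, which makes it closed. *)
Let thin s : set 'rV[RR]_(enr_dim (E0 s)) := [set w | exists2 p, K0 s p & `|w - p| < rad s].
Let thick s : set 'rV[RR]_(enr_dim (E0 s)) := [set w | exists2 p, K0 s p & `|w - p| <= rad s].

Arguments thin : clear implicits.
Arguments thick : clear implicits.
Let thin_thick s : thin s `<=` thick s.
Proof. by move=> w [p Kp wp]; exists p => //; exact: ltW. Qed.
Let thick_dom s : thick s `<=` enr_dom (E0 s).
Proof. by move=> w [p Kp]; exact: radP. Qed.
Let thin_open s : open (thin s). Proof. exact: open_thickening. Qed.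

(* The first component encodes a finite subcomplex, the second one lists the
   coordinates of a map into its Euclidean neighbourhood. *)
Definition problem : Type := (seq nat * seq lat_expr)%type.

(** The stage number decodes to a problem together with a repetition counter. Every problem thus
    recurs at arbitrarily late stages, when all the blocks that it reads are available. *)
Let prob (n : nat) : problem :=
  if @choice.unpickle (nat * problem)%type n is Some jd then jd.2 else ([::], [::]).

Let prob_often (d : problem) (N : nat) : exists2 n, (N <= n)%N & prob n = d.
Proof.
have [[j jN]|H] := pselect (exists j : 'I_N.+1, (N <= choice.pickle ((j : nat, d)))%N).
  by exists (choice.pickle ((j : nat, d))) => //; rewrite /prob choice.pickleK.
(* Pigeonhole: [N + 1] distinct codes cannot all lie below [N]. *)
have small (j : 'I_N.+1) : (choice.pickle (j : nat, d) < N)%N.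
  by rewrite ltnNge; apply/negP => jN; apply: H; exists j.
have inj : injective (fun j : 'I_N.+1 => Ordinal (small j)).
  move=> i j /(congr1 val) /= /(pcan_inj choice.pickleK) [ij]; exact: val_inj.
by have := leq_card _ inj; rewrite !card_ord ltnn.
Qed.

Let sn n := (prob n).1.

Let z0 : lat_expr := ((((0%N, 0%N), (0, 0)), [::]), [::]).
(** Blocks up to [n] hold the point of the cube and the solutions of the stages below [n]; the
    solution of stage [n] itself goes to block [n.+1], so the recursion is well founded. *)
Let trunc n (w : nat -> nat -> RR) := fun b k => if (b <= n)%N then w b k else 0.
Let G n (w : nat -> nat -> RR) : 'rV[RR]_(enr_dim (E0 (sn n))) :=
  \row_i lat_eval (nth z0 (prob n).2 i) (trunc n w).
Let r n := enr_ret (E0 (sn n)).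
Arguments r : clear implicits.

Let G_continuous (Z : topologicalType) (w : Z -> nat -> nat -> RR) n :
  (forall b k, (b <= n)%N -> continuous (fun z => w z b k)) ->
  continuous (fun z => G n (w z)).
Proof.
move=> cw; apply: continuous_row => i.
rewrite [X in continuous X](_ : _ = fun z => lat_eval (nth z0 (prob n).2 i) (trunc n (w z))).
  move=> z; apply: (lat_continuous (w := fun z => trunc n (w z))) => b k.
  by rewrite /trunc; case: (b <= n)%N (cw b k) => cw'; [exact: cw'|exact: cont_cst].
by apply/funext => z; rewrite mxE.
Qed.

Let G_ext n w w' : (forall b k, (b <= n)%N -> w b k = w' b k) -> G n w = G n w'.
Proof.
move=> ww; apply/rowP => i; rewrite !mxE; congr lat_eval.
by apply/funext => b; apply/funext => k; rewrite /trunc; case: ifP => // bn; exact: ww.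
Qed.

(* Block [0] of a point is its position in the Hilbert cube, block [n.+1] encodes
   its image under the solution of the extension problem of stage [n]. *)
Let asm (h : nat -> RR) (y : nat -> L) : nat -> nat -> RR := fun b =>
  if b is n.+1 then pad (enr_in (E2 (sn n)) (y n)) else h.

Let dec_dec2 s : cells_union (dec s) `<=` cells_union (dec2 s).
Proof.
have [_ s1 _] := nextP (dec_sub s); have [_ s2 _] := nextP (dec1_sub s).
by move=> x [i si ix]; exists i => //; apply/s2/s1.
Qed.

Let cr n w : thick (sn n) w -> {for w, continuous (r n)}.
Proof. by move=> /thick_dom; exact: enr_ret_continuous. Qed.

Let rP n w : thick (sn n) w -> cells_union (dec (sn n)) (r n w).
Proof. by move=> /thick_dom; exact: enr_ret_sub. Qed.

(** At stage [n] the values are prescribed by [y n] on [A] and by the retraction on the closed set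
    where the data lie in [thick]; connectedness of the pair extends both at once over [Z]. The pair
    [Qa], [Qb] is a parameter because [K] is lifted along [dec], [dec1], whereas extending from [A]
    uses [dec1], [dec2]. *)
Let lift_stages (Qa Qb : seq nat -> set (cw_I W)) (Z : topologicalType) (A : set Z)
    (h : Z -> nat -> RR) (y : nat -> Z -> L) :
  (forall s, dec s `<=` Qa s) -> (forall s, Qb s `<=` dec2 s) ->
  (forall s, L_connected_Polish L (cells_union (Qa s)) (cells_union (Qb s))) ->
  polish Z -> edim_le Z L -> closed A -> (forall k, continuous (fun z => h z k)) ->
  (forall n, {within A, continuous (y n)}) ->
  (forall n z, A z -> cells_union (Qa (sn n)) (y n z)) ->
  (forall n z, A z -> thick (sn n) (G n (asm (h z) (y^~ z))) ->
     y n z = r n (G n (asm (h z) (y^~ z)))) ->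
  exists y' : nat -> Z -> L, forall n, [/\ continuous (y' n),
    forall z, cells_union (Qb (sn n)) (y' n z), forall z, A z -> y' n z = y n z &
    forall z, thick (sn n) (G n (asm (h z) (y'^~ z))) ->
      y' n z = r n (G n (asm (h z) (y'^~ z)))].
Proof.
move=> decQ Qdec conn pZ eZ cA ch cy yQ yr.
have asm_ext h' (p q : nat -> L) n : (forall m, (m < n)%N -> p m = q m) ->
    forall b k, (b <= n)%N -> asm h' p b k = asm h' q b k.
  by move=> pq [|b] k bn //=; rewrite pq.
apply: (@dependent_choice (Z -> L) (fun=> l0) (fun n p x => [/\ continuous x,
    forall z, cells_union (Qb (sn n)) (x z), forall z, A z -> x z = y n z &
    forall z, thick (sn n) (G n (asm (h z) (p^~ z))) ->
      x z = r n (G n (asm (h z) (p^~ z)))])).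
  move=> n p q x pq [x1 x2 x3 x4]; split=> // z.
  have E : G n (asm (h z) (q^~ z)) = G n (asm (h z) (p^~ z)).
    by apply: G_ext; apply: asm_ext => m mn; rewrite pq.
  by rewrite E; exact: x4.
move=> n p pP.
pose g z := G n (asm (h z) (p^~ z)).
have cg : continuous g.
  apply: G_continuous => -[|b] k bn /=; first exact: ch.
  have [cp pQ _ _] := pP b bn.
  apply: (continuous_comp_fun (f := fun z => enr_in (E2 (sn b)) (p b z))
    (g := fun v => pad v k)); last exact: pad_continuous.
  apply/continuous_subspace_setT.
  apply: (within_comp (B := cells_union (dec2 (sn b))) (f := p b)).
  - exact: continuous_subspaceT.
  - by move=> z _; have [i Qi iz] := pQ z; exists i => //; exact: Qdec.
  - exact: enr_in_continuous.
pose B := g @^-1` thick (sn n).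
have cB : closed B.
  by apply: preimage_closed; [move=> z _; exact: cg|exact: thickening_closed].
have [_ [_ ext]] := conn (sn n) Z pZ eZ.
have yg z : A z -> B z -> y n z = r n (g z).
  move=> Az Bz; have E : G n (asm (h z) (y^~ z)) = g z.
    by apply: G_ext; apply: asm_ext => m mn; have [_ _ pm _] := pP m mn; rewrite pm.
  by rewrite yr// E.
have [|||x [cx [xQ xE]]] := ext (A `|` B) (fun z => if `[< A z >] then y n z else r n (g z)).
- exact: closedU.
- apply: (paste_within (f := y n) (g := r n \o g)) => //.
  apply: (within_comp (B := thick (sn n))) => //; first exact: continuous_subspaceT.
  by apply: continuous_in_subspaceT => w /set_mem; exact: cr.
- move=> _ [z ABz <-]; case: asboolP => Az; first exact: yQ.
  case: ABz => // Bz; have [i si iz] := rP Bz; exists i => //; exact: decQ.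
exists x; split=> //.
- by move=> z; apply: xQ; exists z.
- by move=> z Az; rewrite xE; [rewrite asboolT|left].
- move=> z Bz; rewrite xE; last by right.
  by case: asboolP => // Az; exact: yg.
Qed.

Let Om : topologicalType := prod_topology (fun _ : nat * nat => RR).
Let cur (w : Om) : nat -> nat -> RR := fun b k => w (b, k).

Let cur_continuous b k : continuous (fun w => cur w b k).
Proof. exact: (@proj_continuous _ (fun _ : nat * nat => RR) (b, k)). Qed.

Let Y n (w : Om) : L := enr_ret (E2 (sn n)) (unpad (enr_dim (E2 (sn n))) (cur w n.+1)).

(** All conditions bear on a single point. Hence [Y n], read off block [n.+1], is a ready solution
    of the stage [n] problem on the whole set, wherever the data lie in [thin]. *)
Let Cset : set Om := [set w | (forall k, 0 <= cur w 0%N k <= 1) /\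
  forall n, [/\ (enr_in (E2 (sn n)) @` cells_union (dec2 (sn n))) (unpad _ (cur w n.+1)),
    (forall k, cur w n.+1 k = pad (unpad (enr_dim (E2 (sn n))) (cur w n.+1)) k) &
    (thin (sn n) (G n (cur w)) -> forall k,
       cur w n.+1 k = pad (enr_in (E2 (sn n)) (r n (G n (cur w)))) k)]].

Let cY n w : Cset w -> {for w, continuous (Y n)}.
Proof.
move=> [_ /(_ n) [[x sx xE] _ _]]; apply: cont_comp.
  by apply: unpad_continuous => k; exact: cur_continuous.
by apply: enr_ret_continuous; rewrite -xE; exact: enr_in_dom.
Qed.

Let asmC (h : nat -> RR) (y : nat -> L) (w : Om) :
  cur w = asm h y -> (forall k, 0 <= h k <= 1) ->
  (forall n, cells_union (dec2 (sn n)) (y n)) ->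
  (forall n, thick (sn n) (G n (asm h y)) -> y n = r n (G n (asm h y))) ->
  Cset w.
Proof.
move=> wE h01 yQ yr; split; first by move=> k; rewrite wE.
move=> n; rewrite wE /=; split.
- by rewrite padK; exists (y n).
- by move=> k; rewrite padK.
- by move=> /thin_thick /yr <-.
Qed.

Let YasmE (h : nat -> RR) (y : nat -> L) (w : Om) n :
  cur w = asm h y -> cells_union (dec2 (sn n)) (y n) -> Y n w = y n.
Proof. by move=> wE yQ; rewrite /Y wE /= padK enr_inK. Qed.

Let CasmE (w : Om) : Cset w -> cur w = asm (cur w 0%N) (Y^~ w).
Proof.
move=> [_ wP]; apply/funext => -[|n]//; apply/funext => k /=.
have [[x sx xE] -> _] := wP n; congr pad.
by rewrite /Y -xE enr_inK.
Qed.

Let YC (w : Om) n : Cset w -> thin (sn n) (G n (cur w)) -> Y n w = r n (G n (cur w)).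
Proof.
move=> [_ /(_ n) [_ _ wr]] Vw; rewrite /Y.
rewrite (_ : cur w n.+1 = pad (enr_in (E2 (sn n)) (r n (G n (cur w))))).
  rewrite padK enr_inK//; apply: dec_dec2; exact/rP/thin_thick.
by apply/funext => k; exact: wr.
Qed.

Let Cset_closed : closed Cset.
Proof.
have cnt (f : Om -> RR) c : continuous f -> closed [set w | c <= f w] /\ closed [set w | f w <= c].
  move=> cf; split.
    by apply: (@preimage_closed _ _ f [set x | c <= x]); [move=> x _; exact: cf|exact: closed_ge].
  by apply: (@preimage_closed _ _ f [set x | x <= c]); [move=> x _; exact: cf|exact: closed_le].
have -> : Cset = (\bigcap_k ([set w | 0 <= cur w 0%N k] `&` [set w | cur w 0%N k <= 1])) `&`
  \bigcap_n (((fun w => unpad _ (cur w n.+1)) @^-1`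
      (enr_in (E2 (sn n)) @` cells_union (dec2 (sn n)))) `&`
    (\bigcap_k [set w | cur w n.+1 k - pad (unpad (enr_dim (E2 (sn n))) (cur w n.+1)) k = 0]) `&`
    \bigcap_k [set w | thin (sn n) (G n (cur w)) ->
       cur w n.+1 k = pad (enr_in (E2 (sn n)) (r n (G n (cur w)))) k]).
  apply/seteqP; split=> w.
    move=> [w1 w2]; split; first by move=> k _; have /andP[] := w1 k; split.
    move=> n _; have [wa wb wc] := w2 n; split; first split=> //.
      by move=> k _ /=; rewrite -wb subrr.
    by move=> k _ /= Vw; exact: wc.
  move=> [w1 w2]; split; first by move=> k; have [] := w1 k I => /= -> ->.
  move=> n; have [[wa wb] wc] := w2 n I; split=> // [k|Vw k].
    by have /eqP := wb k I; rewrite subr_eq0 => /eqP.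
  exact: (wc k I).
have cun n : continuous (fun w => unpad (enr_dim (E2 (sn n))) (cur w n.+1)).
  by apply: unpad_continuous => k; exact: cur_continuous.
apply: closedI.
  apply: closed_bigI => k _; have [c1 _] := cnt _ 0 (@cur_continuous 0%N k).
  by have [_ c2] := cnt _ 1 (@cur_continuous 0%N k); exact: closedI.
apply: closed_bigI => n _; apply: closedI; first apply: closedI.
- apply: preimage_closed; first by move=> w _; exact: cun.
  apply: compact_closed; first exact: norm_hausdorff.
  apply: continuous_compact; first exact: enr_in_continuous.
  by have [f c] := dec2_sub (sn n); exact: cells_union_compact.
- apply: closed_bigI => k _; apply: preimage_eq0_closed => w.
  apply: (cont_sub (f := fun w => cur w n.+1 k)
    (g := fun w => pad (unpad (enr_dim (E2 (sn n))) (cur w n.+1)) k)).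
    exact: cur_continuous.
  move: w; apply: (continuous_comp_fun (f := fun w => unpad (enr_dim (E2 (sn n))) (cur w n.+1))
    (g := fun v => pad v k)); [exact: cun|exact: pad_continuous].
apply: closed_bigI => k _; rewrite -openC openE => w /= /not_implyP [Vw ne].
have cG : continuous (fun w : Om => G n (cur w)).
  by apply: G_continuous => b k' _; exact: cur_continuous.
have n1 : \forall w' \near w, thin (sn n) (G n (cur w')).
  by apply: (cG w (thin (sn n))); apply: open_nbhs_nbhs; split=> //; exact: thin_open.
have cin : {for w, continuous (fun w => pad (enr_in (E2 (sn n)) (r n (G n (cur w)))) k)}.
  apply: (cont_comp (f := fun w => G n (cur w)) (g := fun v => pad (enr_in (E2 (sn n)) (r n v)) k)).
    exact: cG.
  apply: (@open_within _ _ (enr_dom (E0 (sn n)))); first exact: enr_open.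
    apply: (within_comp (B := setT) (f := enr_in (E2 (sn n)) \o r n)
      (g := fun v => pad v k)) => //; last first.
      by apply: continuous_subspaceT; exact: pad_continuous.
    apply: (within_comp (B := cells_union (dec2 (sn n)))).
    + by apply: continuous_in_subspaceT => v /set_mem; exact: enr_ret_continuous.
    + by move=> v /(@enr_ret_sub _ _ (E0 (sn n))) /dec_dec2.
    + exact: enr_in_continuous.
  exact/thick_dom/thin_thick.
have n2 : \forall w' \near w,
    0 < `|cur w' n.+1 k - pad (enr_in (E2 (sn n)) (r n (G n (cur w')))) k|.
  apply: (near_gt (f := fun w' =>
    `|cur w' n.+1 k - pad (enr_in (E2 (sn n)) (r n (G n (cur w')))) k|)).
    by apply: cont_abs; apply: (cont_sub (f := fun w => cur w n.+1 k)) => //; exact: cur_continuous.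
  by rewrite normr_gt0 subr_eq0; apply/eqP.
apply: filterS (filterI n1 n2) => w' [V' ne'] /(_ V') E.
by move: ne'; rewrite E subrr normr0 ltxx.
Qed.

Let C : topologicalType := Cset.
Let v (t : C) : Om := set_val t.
Let vP (t : C) : Cset (v t). Proof. exact: set_valP. Qed.
Let cv : continuous v. Proof. exact: initial_continuous. Qed.
Let cvcur b k : continuous (fun t => cur (v t) b k).
Proof. exact: (continuous_comp_fun cv (@cur_continuous b k)). Qed.

Let v_inj (t t' : C) : (forall b k, cur (v t) b k = cur (v t') b k) -> t = t'.
Proof.
move=> H; apply: val_inj; rewrite /= -!set_valE; apply/funext => -[b k]; exact: H.
Qed.

(** The subcomplexes [dec2] are finite, hence compact, so each block is bounded and the set is
    closed in a product of intervals. *)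
Let Cset_compact : compact Cset.
Proof.
have bnd n : exists B : RR, forall x, cells_union (dec2 (sn n)) x -> `|enr_in (E2 (sn n)) x| <= B.
  have [|B [_ bB]] := @compact_bounded _ _ (enr_in (E2 (sn n)) @` cells_union (dec2 (sn n))).
    apply: continuous_compact; first exact: enr_in_continuous.
    by have [f c] := dec2_sub (sn n); exact: cells_union_compact.
  exists (`|B| + 1) => x sx; apply: bB; last by exists x.
  by rewrite (le_lt_trans (ler_norm _))// ltrDl.
have [B BP] := choice bnd.
pose bd (b : nat) : RR := if b is n.+1 then `|B n| else 1.
apply: (subclosed_compact Cset_closed (@tychonoff (nat * nat)%type (fun _ => RR)
  (fun bk => [set x | - bd bk.1 <= x <= bd bk.1]) _)).
  move=> bk; rewrite (_ : [set x | _] = `[- bd bk.1, bd bk.1]%classic).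
    exact: segment_compact.
  by apply/seteqP; split=> x /=; rewrite in_itv.
move=> w [w0 wP] [[|n] k] /=; first by have := w0 k; rewrite /cur; lra.
have [[x sx xE] /(_ k) + _] := wP n; rewrite /cur -xE => ->.
rewrite -ler_norml; apply: (@le_trans _ _ (B n)); last exact: ler_norm.
rewrite /pad; case: insubP => [i _ _|_]; last first.
  by rewrite normr0; exact: le_trans (BP n x sx).
by apply: le_trans (BP n x sx); exact: row_coord_le.
Qed.

Let C_compactum : metrizable_compactum C.
Proof.
have cC : compact [set: C] by exact: compact_set_type.
split=> //; apply: (@separating_metrizable _ (fun m t =>
  if @choice.unpickle (nat * nat)%type m is Some bk then cur (v t) bk.1 bk.2 else 0)) => //.
  by move=> m; case: (choice.unpickle m) => [bk|]; [exact: cvcur|exact: cst_continuous].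
move=> t t' H; apply: v_inj => b k; have := H (choice.pickle (b, k)); by rewrite choice.pickleK.
Qed.

Let C_edim : edim_le C L.
Proof.
split; first by left; exists l0.
move=> A f cA cf.
have nC := metrizable_normal C_compactum.2.
have kA : compact A by exact: (subclosed_compact cA C_compactum.1).
have [J fJ fAJ] : exists2 J, @finite_subcomplex L W J & f @` A `<=` cells_union J.
  by apply: compact_sub_finite_subcomplex => //; exact: continuous_compact.
have [s sJ] := dec_surj fJ; rewrite -{}sJ in fAJ *.
have cif : {within A, continuous (enr_in (E0 s) \o f)}.
  apply: (within_comp (B := cells_union (dec s))) => //; last exact: enr_in_continuous.
  by move=> t At; apply: fAJ; exists t.
have [B [_ bB]] := compact_bounded (@kK0 s).
have [F [cF Ff]] : exists g : C -> 'rV[RR]_(enr_dim (E0 s)), continuous g /\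
    forall t, A t -> g t = enr_in (E0 s) (f t).
  apply: (tietze_row (B := `|B| + 1) nC cA cif) => t At; apply: bB.
    by rewrite (le_lt_trans (ler_norm _))// ltrDl.
  by exists (f t) => //; apply: fAJ; exists t.
have d0 : 0 < rad s / 4 by rewrite divr_gt0.
have ex i : exists e : lat_expr, forall t, `|lat_eval e (cur (v t)) - F t ord0 i| < rad s / 4.
  apply: lattice_dense => //; first exact: C_compactum.1.
  apply: (continuous_comp_fun (g := fun z : 'rV[RR]_(enr_dim (E0 s)) => z ord0 i)) => //.
  exact: coord_continuous.
have [e eP] := choice ex.
pose es := [seq e i | i <- enum 'I_(enr_dim (E0 s))].
have [bd bdP] := choice (fun i => lat_eval_support (e i)).
(* The stage is taken late enough for all the expressions to be unaffected by truncation. *)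
have [n nB pn] := prob_often (s, es) (\max_i bd i).
have gE t i : lat_eval (nth z0 (prob n).2 (i : 'I_(enr_dim (E0 s)))) (trunc n (cur (v t))) =
    lat_eval (e i) (cur (v t)).
  rewrite pn /= (nth_map i) ?size_enum_ord// nth_ord_enum; apply: (bdP i) => b k bi.
  rewrite /trunc ifT//; apply: leq_trans bi _; apply: leq_trans nB.
  exact: leq_bigmax.
have sE : sn n = s by rewrite /sn pn.
clear pn es; subst s.
pose g (t : C) := G n (cur (v t)).
have gF t : `|g t - F t| <= rad (sn n) / 4.
  by apply: row_norm_le => [|i]; [exact: ltW|rewrite !mxE gE; exact: ltW].
have cg : continuous g by apply: G_continuous => b k _; exact: cvcur.
have h2 : rad (sn n) / 2 <= rad (sn n) by have := rad0 (sn n); lra.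
(* Over [N] the data [F] are within half of [rad] of [K0], and [g] is within a quarter of [F]. So
   [g] and the segments from [F] to [g] stay within three quarters of [rad]: inside [thin], where
   [Y n] is the retraction of [g], and inside the domain of the retraction. *)
pose U := F @^-1` [set w | exists2 p, K0 (sn n) p & `|w - p| < rad (sn n) / 2].
pose N := F @^-1` [set w | exists2 p, K0 (sn n) p & `|w - p| <= rad (sn n) / 2].
have [||||||||||Phi [cPhi PhiA _ _]] := @patch C L _ (enr_dom (E0 (sn n))) (r n) F g
    (fun t => Y n (v t)) A U N nC cA => //.
- by apply: open_comp; [move=> t _; exact: cF|exact: open_thickening].
- by apply: preimage_closed; [move=> t _; exact: cF|exact: thickening_closed].
- move=> t At; exists (F t); first by rewrite Ff//; exists (f t) => //; apply: fAJ; exists t.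
  by rewrite subrr normr0; have := rad0 (sn n); lra.
- by move=> t [p Kp Fp]; exists p => //; exact: ltW.
- exact: enr_ret_continuous.
- by move=> t; apply: (cont_comp (f := v) (g := Y n)); [exact: cv|exact: cY (vP t)].
- move=> t s [p Kp Fp] /andP[s0 s1]; apply: (radP Kp).
  rewrite (_ : _ - p = ((1 - s) *: F t + s *: g t - F t) + (F t - p)).
    apply: (le_trans (ler_normD _ _)); rewrite segment_sub normrZ ger0_norm//.
    have : s * `|g t - F t| <= rad (sn n) / 4.
      by apply: le_trans (gF t); rewrite ler_piMl.
    by move: (rad0 (sn n)) Fp; lra.
  by rewrite addrA subrK.
- move=> t [p Kp Fp]; apply: YC => //; exists p => //.
  rewrite (_ : _ - p = (g t - F t) + (F t - p)); last by rewrite addrA subrK.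
  apply: (le_lt_trans (ler_normD _ _)).
  by move: (gF t) (rad0 (sn n)) Fp; lra.
exists Phi; split=> // t At; rewrite PhiA// Ff// /r enr_inK//.
by apply: fAJ; exists t.
Qed.

Let asmW (h : nat -> RR) (y : nat -> L) : Om := fun bk => asm h y bk.1 bk.2.

Let asm_continuous (Z : topologicalType) (h : Z -> nat -> RR) (y : nat -> Z -> L) :
  (forall k, continuous (fun z => h z k)) -> (forall n, continuous (y n)) ->
  (forall n z, cells_union (dec2 (sn n)) (y n z)) ->
  continuous (fun z => asmW (h z) (y^~ z)).
Proof.
move=> ch cy yQ; apply: prod_continuous => -[[|n] k]; first exact: ch.
apply: (continuous_comp_fun (f := fun z => enr_in (E2 (sn n)) (y n z))
  (g := fun v => pad v k)); last exact: pad_continuous.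
apply/continuous_subspace_setT.
apply: (within_comp (B := cells_union (dec2 (sn n))) (f := y n)) => //.
- exact: continuous_subspaceT.
- exact: enr_in_continuous.
Qed.

Let to_C (Z : topologicalType) (h : Z -> nat -> RR) (y : nat -> Z -> L) :
  (forall k, continuous (fun z => h z k)) -> (forall z k, 0 <= h z k <= 1) ->
  (forall n, [/\ continuous (y n), forall z, cells_union (dec2 (sn n)) (y n z) &
    forall z, thick (sn n) (G n (asm (h z) (y^~ z))) ->
      y n z = r n (G n (asm (h z) (y^~ z)))]) ->
  exists g : Z -> C, continuous g /\ forall z, cur (v (g z)) = asm (h z) (y^~ z).
Proof.
move=> ch h01 yP.
have wC z : Cset (asmW (h z) (y^~ z)).
  apply: (@asmC (h z) (y^~ z)) => //.
  - by move=> n; have [_ + _] := yP n.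
  - by move=> n; have [_ _] := yP n; apply.
exists (fun z => exist _ (asmW (h z) (y^~ z)) (mem_set (wC z))); split.
  apply: continuous_comp_initial; apply: asm_continuous => // n; first by case: (yP n).
  by move=> z; have [_ + _] := yP n.
by move=> z; rewrite /v set_valE.
Qed.

Lemma connected_pair_construction (K : topologicalType) :
  metrizable_compactum K -> edim_le K L ->
  exists (C : topologicalType) (e : K -> C),
    embedding e /\ metrizable_compactum C /\ edim_le C L /\
    L_connected_Polish L (range e) [set: C].
Proof.
move=> cmK eK; have pK := metrizable_compactum_polish cmK.
have [phi [cphi phi01 sphi]] := metrizable_compactum_separating cmK.
have dec_dec1 s : dec s `<=` dec1 s by case: (nextP (dec_sub s)).
have dec1_dec2 s : dec1 s `<=` dec2 s by case: (nextP (dec1_sub s)).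
have conn1 s : L_connected_Polish L (cells_union (dec s)) (cells_union (dec1 s)).
  by case: (nextP (dec_sub s)).
have conn2 s : L_connected_Polish L (cells_union (dec1 s)) (cells_union (dec2 s)).
  by case: (nextP (dec1_sub s)).
(* The case of empty [A]: it embeds [K], and it also provides a point of [C] when [Z] is
   nonempty. *)
have lift0 (Z : topologicalType) (h : Z -> nat -> RR) : polish Z -> edim_le Z L ->
    (forall k, continuous (fun z => h z k)) ->
    exists y : nat -> Z -> L, forall n, [/\ continuous (y n),
      forall z, cells_union (dec1 (sn n)) (y n z) &
      forall z, thick (sn n) (G n (asm (h z) (y^~ z))) ->
        y n z = r n (G n (asm (h z) (y^~ z)))].
  move=> pZ eZ ch.
  have [|||y yP] := lift_stages (A := set0) (y := fun _ _ => l0) (Qa := dec) (Qb := dec1)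
    (fun s => @subset_refl _ _) dec1_dec2 conn1 pZ eZ closed0 ch => //.
    by move=> n; exact: continuous_subspace0.
  by exists y => n; have [? ? _ ?] := yP n.
have cph k : continuous (fun x => phi k x) by exact: cphi.
have [y yP] := lift0 K (fun x k => phi k x) pK eK cph.
have sub12 n x : cells_union (dec1 (sn n)) x -> cells_union (dec2 (sn n)) x.
  by move=> [i si ix]; exists i => //; exact: dec1_dec2.
have [|||e [ce eE]] := @to_C K (fun x k => phi k x) y => //.
  by move=> n; have [y1 y2 y3] := yP n; split=> // z; exact: sub12.
have hC := metrizable_hausdorff C_compactum.2.
have ie : injective e.
  move=> x x' xx; apply: sphi => k.
  by have := congr1 (fun t => cur (v t) 0%N k) xx; rewrite !eE.
exists C, e; split; first split=> //; first split=> //.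
  (* Images of closed subsets of [K] are compact, hence closed in [C]. *)
  move=> O oO; exists (~` (e @` ~` O)); split.
    apply: closed_openC; apply: compact_closed => //.
    apply: continuous_compact; first exact: continuous_subspaceT.
    by apply: subclosed_compact cmK.1 _ => //; exact: open_closedC.
  apply/seteqP; split=> [_ [x Ox <-]|t [nO [x _ xe]]].
    by split; [move=> [x' nOx' /ie xx]; apply: nOx'; rewrite xx|exists x].
  exists x => //; apply: contrapT => nOx; apply: nO; exists x => //.
split; first exact: C_compactum.
split; first exact: C_edim.
move=> Z pZ eZ; have nZ := polish_normal pZ; split=> //; split.
  have [[z _]|nz] := pselect (exists z : Z, True); [left|by right].
  have c0 (k : nat) : continuous (fun _ : Z => (0 : RR)) by exact: cst_continuous.
  have [y0 y0P] := lift0 Z (fun _ _ => 0) pZ eZ c0.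
  have [|||g _] := @to_C Z (fun _ _ => 0) y0 => //.
    by move=> _ _; rewrite lexx ler01.
    by move=> n; have [y1 y2 y3] := y0P n; split=> // z'; exact: sub12.
  by exists (g z).
move=> A f cA cf fA.
have fe z : A z -> exists x, e x = f z.
  by move=> Az; have [|x _ xe] := fA (f z); [exists z|exists x].
have exh k : exists g : Z -> RR, [/\ continuous g, forall z, 0 <= g z <= 1 &
    forall z, A z -> g z = cur (v (f z)) 0%N k].
  apply: tietze01 => //.
    apply: (within_comp (B := setT) (g := fun t => cur (v t) 0%N k)) => //.
    by apply: continuous_subspaceT; exact: cvcur.
  by move=> z _; have [+ _] := vP (f z); apply.
have [hh hhP] := choice exh.
pose h z k := hh k z.
have hE z : A z -> h z = cur (v (f z)) 0%N.
  by move=> Az; apply/funext => k; rewrite /h; have [_ _ ->] := hhP k.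
pose yf n z := Y n (v (f z)).
have fE z : A z -> asm (h z) (yf^~ z) = cur (v (f z)).
  by move=> Az; rewrite hE// -CasmE//; exact: vP.
have yfE x n : Y n (v (e x)) = y n x.
  apply: (@YasmE (phi^~ x) (y^~ x)); first exact: eE.
  by apply: sub12; have [_ + _] := yP n.
have [||||y' y'P] := lift_stages (A := A) (h := h) (y := yf) (Qa := dec1) (Qb := dec2)
  dec_dec1 (fun s => @subset_refl _ _) conn2 pZ eZ cA => //.
- by move=> k; have [] := hhP k.
- move=> n; apply: (within_comp (B := setT) (g := fun t => Y n (v t))) => //.
  apply: continuous_subspaceT => t; apply: (cont_comp (f := v) (g := Y n)); first exact: cv.
  exact: cY (vP t).
(* As [f] takes values in [range e], its blocks come from solutions over [K], which lie in [dec1]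
   and not only in [dec2]. *)
- move=> n z Az; have [x xe] := fe z Az; rewrite /yf -xe yfE.
  by have [_ + _] := yP n.
(* The solutions over [K] obey the retraction on the closed [thick], which is more than membership
   in [Cset] records on [thin]. *)
- move=> n z Az; rewrite fE//; have [x xe] := fe z Az; rewrite /yf -xe yfE eE.
  by have [_ _] := yP n; apply.
have [|||g [cg gE]] := @to_C Z h y'.
- by move=> k; have [] := hhP k.
- by move=> z k; have [_ + _] := hhP k; apply.
- by move=> n; have [y1 y2 _ y3] := y'P n.
exists g; split=> //; split=> // z Az.
apply: v_inj => b k; rewrite gE -fE//; congr (asm _ _ _ _).
by apply/funext => n; have [_ _ -> // _] := y'P n.
Qed.

End construction.

Lemma quasi_finite_connected_pairs (L : topologicalType) (W : cell_data L) :
  is_CW W -> CW_countable W -> CW_locally_finite W -> quasi_finite W ->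
  connected_pairs_property L.
Proof.
move=> cwW ctW lfW qf K cmK eK.
(* An empty [L] forces every admissible [Z] to be empty, and [K] itself serves as [C]. *)
have [[l0 _]|nL] := pselect (exists l : L, True); last first.
  exists K, idfun; split.
    split; first by move=> x; exact: cvg_id.
    split=> // O oO; exists O; split=> //.
    by apply/seteqP; split=> [_ [x Ox <-]|x [Ox _]]; [split=> //; exists x|exists x].
  split=> //; split=> // Z pZ [[[l _]|nZ] _]; first by exfalso; apply: nL; exists l.
  split=> //; split; first by right.
  move=> A f cA cf fA; exists f; split=> [x|]; first by exfalso; apply: nZ; exists x.
  by split.
have /countable_injP [code codeI] : countable [set: cw_I W] by [].
have ex J : exists J', @finite_subcomplex L W J -> [/\ @finite_subcomplex L W J', J `<=` J' &
    L_connected_Polish L (cells_union J) (cells_union J')].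
  have [[fJ sJ]|nJ] := pselect (@finite_subcomplex L W J); last by exists J.
  by have [J' [? [? [? ?]]]] := qf J fJ sJ; exists J'.
have [next nextP] := choice ex.
apply: (@connected_pair_construction L W l0 cwW lfW code _ next) => //.
by move=> i j ij; apply: codeI => //; exact: mem_set.
Qed.

Theorem theorem3p4 (L : topologicalType) (W : cell_data L) :
  is_CW W -> CW_countable W -> CW_locally_finite W ->
  (connected_pairs_property L <-> quasi_finite W).
Proof.
move=> cwW ctW lfW; split.
- exact: connected_pairs_quasi_finite.
- exact: quasi_finite_connected_pairs.
Qed.
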